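(* Let $H$ be a separable Hilbert space, let $X$ be an $H$-valued random variable satisfying assumptions (A1) and (A2) given in the context, and let $m$ be its geometric median. Let $\alpha\in(1/2,1)$, $c_\gamma>0$, $\gamma_n=c_\gamma n^{-\alpha}$, let $(Z_n)_{n\ge 1}$ be the stochastic gradient sequence $$Z_{n+1}=Z_n+\gamma_n\frac{X_{n+1}-Z_n}{\|X_{n+1}-Z_n\|},\qquad n\ge 1,$$ where $X_1,X_2,\dots$ are independent copies of $X$ and $Z_1$ is bounded, and let $\overline{Z}_n=\frac1n\sum_{k=1}^n Z_k$ be its averaged version. Then there is a positive constant $c$ such that for all $n\ge 1$, $$\mathbb{E}\left[\|\overline{Z}_n-m\|^{2}\right]\ge \frac{c}{n}.$$
   Context: $H$ is a separable Hilbert space (possibly infinite dimensional) with inner product $\langle\cdot,\cdot\rangle$ and norm $\|\cdot\|$. The geometric median of $X$ is $m:=\arg\min_{h\in H}\mathbb{E}[\|X-h\|-\|X\|]$. No moment assumption is made on $X$. Assumptions: (A1) For all $h\in H$ there is $h'\in H$ such that $\langle h,h'\rangle=0$ and $\mathrm{Var}(\langle X,h'\rangle)>0$. (This ensures that $m$ is uniquely defined.) (A2) There is a positive constant $C$ such that for all $h\in H$, $\mathbb{E}[1/\|X-h\|]\le C$ and $\mathbb{E}[1/\|X-h\|^2]\le C$. $X_1,X_2,\dots$ are independent random variables with the same law as $X$. The initialization $Z_1$ is bounded (for instance $Z_1=X_1\mathbf 1_{\{\|X_1\|\le M\}}$ with $M$ a constant) or deterministic; it is measurable with respect to $\sigma(X_1)$.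 The event $X_{n+1}=Z_n$ has probability zero under (A2).
   Formalization: For n = 1 the bound is claimed only when Z_1 is not almost surely equal to m: if Z_1 = m almost surely (e.g. deterministic Z_1 = m), the left side is 0 at n = 1 and the claim fails; for n ≥ 2 nothing is added. *)

(* Defs.v *)
From HB Require Import structures.
From mathcomp Require Import all_boot all_order all_algebra.
From mathcomp Require Import finmap.
From mathcomp Require Import all_classical all_reals all_analysis.

Set Implicit Arguments.
Unset Strict Implicit.
Unset Printing Implicit Defensive.

Import Order.TTheory GRing.Theory Num.Theory.
Import numFieldNormedType.Exports.

Local Open Scope classical_set_scope.
Local Open Scope ring_scope.

(* [H] with its Borel sigma-algebra. *)
Definition borelType (R : realType) (H : normedModType R) :=
  g_sigma_algebraType (@open H).

Definition separable_space (T : topologicalType) :=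
  exists2 D : set T, countable D & dense D.

(* A real Hilbert space is a complete normed module whose norm is induced by
   the positive definite symmetric bilinear form [ip]. *)
Definition norm_induced_by (R : realType) (H : normedModType R)
    (ip : {dot H for @idfun R}) :=
  forall x : H, `|x| ^+ 2 = ip x x.

Definition mutually_independent d d' (T : measurableType d)
    (T' : measurableType d') (R : realType) (P : probability T R)
    (I : choiceType) (D : set I) (X : I -> {RV P >-> T'}) :=
  forall (J : {fset I}) (B : I -> set T'), [set` J] `<=` D ->
    (forall i, i \in J -> measurable (B i)) ->
    (P (\bigcap_(i in [set` J]) (X i @^-1` B i)) =
       \prod_(i <- J) P (X i @^-1` B i))%E.

(* Equality of laws is only asked on measurable sets: a [distribution] is a
   function on all sets, with unspecified values on the nonmeasurable ones. *)
Definition same_law d d' (T : measurableType d) (T' : measurableType d')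
    (R : realType) (P : probability T R) (X Y : {RV P >-> T'}) :=
  forall B : set T', measurable B -> distribution P X B = distribution P Y B.

(* [Y] is measurable with respect to the sigma-algebra generated by [X]. *)
Definition sigma_measurable d d' d'' (T : measurableType d)
    (T' : measurableType d') (T'' : measurableType d'')
    (X : T -> T') (Y : T -> T'') :=
  @measurable_fun _ _ (g_sigma_algebra_preimageType X) T'' setT Y.

Section median.
Context d (T : measurableType d) (R : realType) (P : probability T R).
Variable H : completeNormedModType R.
Implicit Types (ip : {dot H for @idfun R}) (X : {RV P >-> borelType H}).

(* The integrand is bounded by [`|h|], so no moment of [X] is needed. *)
Definition median_objective X (h : H) : \bar R :=
  ('E_P[(fun w => `|(X w : H) - h| - `|X w : H|)%R])%E.

Definition geometric_median X (m : H) :=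
  forall h : H, (median_objective X m <= median_objective X h)%E.

(* ['V_P[Y]] takes values in [\bar R] and equals [+oo] as soon as the real
   random variable [Y] is not square integrable (even if it is not
   integrable), so that [0 < 'V_P[Y]] makes sense without moment assumption
   and holds iff [Y] is not almost surely constant. *)
Definition not_on_a_line ip X :=
  forall h : H, exists h' : H,
    ip h h' = 0 /\ (0 < 'V_P[fun w => ip (X w : H) h'])%E.

(* The inverses are taken in [\bar R], where [0^-1 = +oo]: an atom of [X] at
   [h] makes both expectations infinite. *)
Definition bounded_inverse_moments X :=
  exists2 C : R, 0 < C & forall h : H,
    (\int[P]_w (`|(X w : H) - h|%R%:E)^-1 <= C%:E)%E /\
    (\int[P]_w ((`|(X w : H) - h| ^+ 2)%R%:E)^-1 <= C%:E)%E.

(* Since [0^-1 = 0] in [R], the direction is [0] when [X n.+1 w = Z n w]. *)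
Definition stochastic_gradient (gamma : nat -> R)
    (X : nat -> {RV P >-> borelType H}) (Z : nat -> T -> H) :=
  forall n, (1 <= n)%N -> forall w : T,
    Z n.+1 w = Z n w +
      gamma n *: (`|(X n.+1 w : H) - Z n w|^-1 *: ((X n.+1 w : H) - Z n w)).

Definition averaged (Z : nat -> T -> H) (n : nat) (w : T) : H :=
  n%:R^-1 *: \sum_(1 <= k < n.+1) Z k w.

End median.

(* Main.v *)
(* Pairing the recursion with a fixed vector e, dividing by gamma_k and summing
   expresses n <Hess (Zbar_n - m), e> as a martingale with bounded increments,
   plus an Abel remainder controlled by |Z_k - m| and a linearization error
   controlled by the sum of the |Z_k - m|^2. The exponential Lyapunov function
   exp(sqrt(1 + |Z_n - m|^2) - 1) - 1 yields E|Z_n - m|^2 = O(gamma_n), so that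
   both errors are o(sqrt n) in L^1 because alpha > 1/2. The martingale has
   second moment of order n and fourth moment of order n^2, hence first moment
   of order sqrt n. This gives the bound for large n; for a fixed n >= 2, if
   Zbar_n were almost surely m then the direction of X_n - Z_{n-1} would be
   determined by the past, and X would be supported by a line. *)
Require Import Defs.
From HB Require Import structures.
From mathcomp Require Import all_boot all_order all_algebra.
From mathcomp Require Import finmap ring lra.
From mathcomp Require Import all_classical all_reals all_analysis.
From mathcomp Require Import measurable_realfun.

Set Implicit Arguments.
Unset Strict Implicit.
Unset Printing Implicit Defensive.

Import Order.TTheory GRing.Theory Num.Theory.
Import numFieldNormedType.Exports.

Local Open Scope classical_set_scope.
Local Open Scope ring_scope.

(** * Inner products and the direction map *)

(** The target is a second moment, yet the comparison is made between first moments. The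
    linearization error is a sum of squares |Z_k - m|^2, so bounding it in L^2 would need fourth
    moments of Z_k - m; in L^1 the mean-square rate is enough. Jensen's inequality returns to the
    second moment at the end. A lower bound on the first moment of the martingale is not given by
    its variance alone, whence the fourth moment, which rules out mass escaping to large values.

    A single direction e suffices for a lower bound; it only has to carry some limiting variance of
    the unit steps.

    The function |Z_n - m|^2 itself is not contracted by a constant factor: far from m the mean step
    has norm at most 1, so the drift of the square grows only linearly in the distance. The
    exponential growth of the Lyapunov function compensates for this, and bounded steps keep its
    increments under control.

    The two inverse moments play different roles: the first makes the gradient Lipschitz and its
    Hessian bounded, the second makes the linearization error quadratic without any restriction on
    the size of Z_k - m. *)

Definition inner_product (R : realType) (H : normedModType R)
    (f : H -> H -> R) :=
  [/\ forall x y, f x y = f y x,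
      forall a x y z, f (a *: x + y) z = a * f x z + f y z &
      forall x, `|x| ^+ 2 = f x x].

Lemma dot_inner_product (R : realType) (H : normedModType R)
    (ip : {dot H for @idfun R}) :
  norm_induced_by ip -> inner_product ip.
Proof.
move=> nip; split.
- by move=> x y; have := hermC ip x y; rewrite expr0 mul1r.
- by move=> a x y z; rewrite linearDl linearZl_LR.
- exact: nip.
Qed.

HB.lock Definition dir (R : realType) (H : normedModType R) (x : H) : H :=
  `|x|^-1 *: x.
Canonical dir_unlockable := Unlockable dir.unlock.
Arguments dir {R H} x.

Section inner_product_theory.
Context (R : realType) (H : normedModType R) (ip : H -> H -> R).
Hypothesis ipP : inner_product ip.
Implicit Types (x y z u v e h : H) (a : R).

Lemma ipC x y : ip x y = ip y x. Proof. by case: ipP. Qed.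
Lemma ipxx x : ip x x = `|x| ^+ 2. Proof. by case: ipP. Qed.
Lemma ipPl a x y z : ip (a *: x + y) z = a * ip x z + ip y z.
Proof. by case: ipP. Qed.

Lemma ip0l z : ip 0 z = 0.
Proof.
have := ipPl 1 0 0 z; rewrite scale1r add0r mul1r => /eqP.
by rewrite -subr_eq subrr => /eqP.
Qed.
Lemma ipDl x y z : ip (x + y) z = ip x z + ip y z.
Proof. by have := ipPl 1 x y z; rewrite scale1r mul1r. Qed.
Lemma ipZl a x z : ip (a *: x) z = a * ip x z.
Proof. by have := ipPl a x 0 z; rewrite !addr0 ip0l addr0. Qed.
Lemma ipNl x z : ip (- x) z = - ip x z.
Proof. by rewrite -scaleN1r ipZl mulN1r. Qed.
Lemma ipBl x y z : ip (x - y) z = ip x z - ip y z.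
Proof. by rewrite ipDl ipNl. Qed.
Lemma ip0r z : ip z 0 = 0. Proof. by rewrite ipC ip0l. Qed.
Lemma ipDr x y z : ip z (x + y) = ip z x + ip z y.
Proof. by rewrite ipC ipDl !(ipC z). Qed.
Lemma ipZr a x z : ip z (a *: x) = a * ip z x.
Proof. by rewrite ipC ipZl (ipC z). Qed.
Lemma ipNr x z : ip z (- x) = - ip z x.
Proof. by rewrite ipC ipNl (ipC z). Qed.
Lemma ipBr x y z : ip z (x - y) = ip z x - ip z y.
Proof. by rewrite ipDr ipNr. Qed.
Lemma normBsq x y : `|x - y| ^+ 2 = `|x| ^+ 2 - 2 * ip x y + `|y| ^+ 2.
Proof. by rewrite -!ipxx !(ipBl, ipBr) (ipC y x); ring. Qed.

Lemma normDsq x y : `|x + y| ^+ 2 = `|x| ^+ 2 + 2 * ip x y + `|y| ^+ 2.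
Proof. by rewrite -!ipxx !(ipDl, ipDr) (ipC y x); ring. Qed.

Lemma polarization x y :
  ip x y = 2^-1 * (`|x| ^+ 2 + `|y| ^+ 2 - `|x - y| ^+ 2).
Proof. by rewrite normBsq; field. Qed.

Lemma cauchy_schwarz x y : `|ip x y| <= `|x| * `|y|.
Proof.
rewrite -(@ler_pXn2r _ 2) ?nnegrE ?mulr_ge0// exprMn real_normK ?num_real//.
have [->|y0] := eqVneq y 0; first by rewrite ip0r normr0 !expr0n mulr0.
have yy : 0 < `|y| ^+ 2 by rewrite exprn_gt0 ?normr_gt0.
have := sqr_ge0 `| `|y| ^+ 2 *: x - ip x y *: y|.
rewrite normBsq ipZl ipZr !normrZ !exprMn !real_normK ?num_real//.
set b := `|y| ^+ 2 in yy *; set a := `|x| ^+ 2; set c := ip x y.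
rewrite (_ : _ + _ = b * (a * b - c ^+ 2)); last by rewrite /b; ring.
by rewrite pmulr_rge0// subr_ge0.
Qed.

Lemma dir0 : dir (0 : H) = 0. Proof. by rewrite dir.unlock scaler0. Qed.

Lemma norm_dir x : x != 0 -> `|dir x| = 1.
Proof.
by move=> x0; rewrite dir.unlock normrZ normfV normr_id mulVf ?normr_eq0.
Qed.

Lemma norm_dir_le1 x : `|dir x| <= 1.
Proof.
have [->|/norm_dir->//] := eqVneq x 0; by rewrite dir0 normr0 ler01.
Qed.

Lemma dirE x : x = `|x| *: dir x.
Proof.
have [->|x0] := eqVneq x 0; first by rewrite dir0 scaler0.
by rewrite dir.unlock scalerA mulfV ?normr_eq0// scale1r.
Qed.

Lemma ip_dir x : ip (dir x) x = `|x|.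
Proof.
have [->|x0] := eqVneq x 0; first by rewrite ip0r normr0.
by rewrite dir.unlock ipZl ipxx expr2 mulrA mulVf ?normr_eq0// mul1r.
Qed.

Lemma ip_dir_le x e : `|ip (dir x) e| <= `|e|.
Proof.
by rewrite (le_trans (cauchy_schwarz _ _))// ler_piMl// norm_dir_le1.
Qed.

Lemma ip_dir_sqr_le x e : ip (dir x) e ^+ 2 <= `|e| ^+ 2.
Proof.
rewrite -[leLHS]real_normK ?num_real//.
by rewrite lerXn2r ?nnegrE// ip_dir_le.
Qed.

(** Multiplied by |x|, the difference of directions is (x - y) + (|y| - |x|) dir y, and each term
    has norm at most |x - y|. Only the inverse norm of x appears, so one inverse moment will control
    a difference of gradients. *)
Lemma dir_lipschitz x y : x != 0 ->
  `|dir x - dir y| <= 2 * (`|x - y| * `|x|^-1).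
Proof.
move=> x0; have nx : 0 < `|x| by rewrite normr_gt0.
rewrite mulrA ler_pdivlMr//.
have -> : `|dir x - dir y| * `|x| = `|x - y + (`|y| - `|x|) *: dir y|.
  rewrite mulrC -[in LHS](normr_id x) -normrZ scalerBr -dirE scalerBl -dirE.
  by rewrite addrA subrK.
rewrite (le_trans (ler_normD _ _))// mulr_natl mulr2n lerD//.
rewrite normrZ (le_trans (ler_wpM2l _ (norm_dir_le1 _)))// mulr1.
by rewrite distrC ler_dist_dist.
Qed.

(** [dir] is a subgradient of the norm, which is convex. *)
Lemma dir_monotone x y : 0 <= ip (dir x - dir y) (x - y).
Proof.
rewrite ipBl !ipBr !ip_dir.
have := ip_dir_le x y; have := ip_dir_le y x.
by rewrite !ler_norml; lra.
Qed.

Lemma norm_subgradient x e : `|x| - `|x + e| <= - ip (dir x) e.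
Proof.
have := ip_dir_le x (x + e); rewrite ler_norml ipDr ip_dir; lra.
Qed.

(** Taylor estimate for the gradient of the norm, whose derivative at x is the projection orthogonal
    to x divided by |x|. It is global in v: near the singularity v = x the right-hand side is
    already of order 1. *)
Lemma dir_expansion x v : x != 0 ->
  `|dir (x - v) - dir x + `|x|^-1 *: (v - ip (dir x) v *: dir x)|
    <= 4 * (`|v| ^+ 2 * `|x| ^- 2).
Proof.
move=> x0; have nx : 0 < `|x| by rewrite normr_gt0.
set N := `|x| in nx *; set s := `|x - v|; set p := ip (dir x) v.
have pv : `|p| <= `|v| by exact: ip_dir_le.
(* Here [dir 0 = 0]: the left side is |dir x| = 1 and the right side is 4. *)
have [y0|y0] := eqVneq (x - v) 0.
  have -> : v = x by move/eqP: y0; rewrite subr_eq0 => /eqP.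
  have dx : N^-1 *: x = dir x by rewrite dir.unlock.
  rewrite -/N subrr dir0 add0r scalerBr dx.
  rewrite /p (_ : v = x); last by move/eqP: y0; rewrite subr_eq0 => /eqP.
  rewrite ip_dir scalerA mulVf ?gt_eqF// scale1r subrr addr0 normrN norm_dir//.
  by rewrite divff ?gt_eqF ?exprn_gt0//; lra.
have s0 : 0 < s by rewrite normr_gt0.
have sv : `|N - s| <= `|v|.
  by rewrite (le_trans (ler_dist_dist _ _))// subKr.
have s2 : s ^+ 2 = N ^+ 2 - 2 * (N * p) + `|v| ^+ 2.
  by rewrite normBsq [in ip x v](dirE x) ipZl.
(* The second-order remainder of 1/|x - v|. Regrouping along v and x - v leaves -(p / N^2) v, of
   size |v|^2 / N^2, and k (x - v), bounded by three times as much. *)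
pose k := s^-1 - N^-1 - p * N ^- 2.
have -> : dir (x - v) - dir x + N^-1 *: (v - p *: dir x) =
    - (p * N ^- 2) *: v + k *: (x - v).
  have xE : x = (x - v) + v by rewrite subrK.
  have -> : dir (x - v) = s^-1 *: (x - v) by rewrite dir.unlock.
  have -> : dir x = N^-1 *: x by rewrite dir.unlock.
  have -> : N^-1 *: (v - p *: (N^-1 *: x)) = N^-1 *: v - (p * N ^- 2) *: x.
    rewrite scalerBr !scalerA; congr (_ - _ *: _).
    by rewrite mulrAC -exprVn expr2 mulrC.
  rewrite [in RHS]/k [(_ - _ - _) *: _]scalerBl [(s^-1 - _) *: _]scalerBl.
  rewrite scaleNr [RHS]addrC -[RHS]addrA -opprD -scalerDr subrK.
  by rewrite [N^-1 *: (_ - _)]scalerBr opprB !addrA [in RHS]addrAC.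
apply: le_trans (ler_normD _ _) _; rewrite !normrZ -/s.
have sk : `|k| * s <= 3 * (`|v| ^+ 2 * N ^- 2).
  rewrite -[X in _ * X <= _]gtr0_norm// -normrM.
  have Ns : 0 < N + s by rewrite addr_gt0.
  (* The first-order terms have cancelled: both |p| and |N - s| are at most |v|, so every term of
     the numerator is quadratic in v. *)
  have -> : k * s = (p * (N - s) * (2 * N + s) - N * `|v| ^+ 2) / (N ^+ 2 * (N + s)).
    rewrite /k. have : `|v| ^+ 2 = s ^+ 2 - N ^+ 2 + 2 * (N * p) by lra.
    by move=> ->; field; rewrite !gt_eqF.
  rewrite normrM normfV [X in _ / X]gtr0_norm ?mulr_gt0 ?exprn_gt0//.
  rewrite ler_pdivrMr ?mulr_gt0 ?exprn_gt0//.
  have -> : 3 * (`|v| ^+ 2 * N ^- 2) * (N ^+ 2 * (N + s)) = 3 * `|v| ^+ 2 * (N + s).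
    by field; rewrite gt_eqF.
  rewrite (le_trans (ler_normB _ _))// !normrM (gtr0_norm nx).
  rewrite (@gtr0_norm _ (2 * N + s)); last lra.
  rewrite normr_id.
  have : `|p| * `|N - s| <= `|v| * `|v| by exact: ler_pM.
  have : 0 <= `|p| * `|N - s| by rewrite mulr_ge0.
  nra.
have : `|- (p * N ^- 2)| * `|v| <= `|v| ^+ 2 * N ^- 2.
  rewrite normrN normrM (@ger0_norm _ (N ^- 2)) ?invr_ge0 ?exprn_ge0 ?(ltW nx)//.
  rewrite mulrAC (expr2 `|v|); apply: ler_wpM2r; last exact: ler_wpM2r.
  by rewrite invr_ge0 exprn_ge0 ?ltW.
lra.
Qed.

Lemma dir_expansion_ip x v e : x != 0 ->
  `|ip (dir (x - v)) e - ip (dir x) e +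
    `|x|^-1 * (ip v e - ip (dir x) v * ip (dir x) e)|
    <= 4 * `|v| ^+ 2 * `|e| * `|x| ^- 2.
Proof.
move=> x0; rewrite -(ipZl (ip (dir x) v)) -!ipBl -ipZl -ipDl.
rewrite (le_trans (cauchy_schwarz _ _))//.
rewrite (le_trans (ler_wpM2r (normr_ge0 e) (dir_expansion v x0)))//.
by rewrite le_eqVlt; apply/orP; left; apply/eqP; ring.
Qed.

(** A triangle inequality for squared sines of angles between lines. The vector u - ab v is the sum
    of u - a h and a (h - b v), with squared norms 1 - a^2 and a^2 (1 - b^2); its own squared norm
    is 1 - c^2 + (c - ab)^2. *)
Lemma unit_angle u v h : `|u| = 1 -> `|v| = 1 -> `|h| = 1 ->
  1 - ip u v ^+ 2 <= 2 * (1 - ip u h ^+ 2) + 2 * (1 - ip v h ^+ 2).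
Proof.
move=> u1 v1 h1; set a := ip u h; set b := ip v h.
have := sqr_ge0 `|(u - a *: h) - (a *: h - (a * b) *: v)|.
rewrite -ipxx !(ipBl, ipBr, ipZl, ipZr) !ipxx u1 v1 h1 (ipC h u) (ipC v u) (ipC h v).
rewrite -/a -/b; set c := ip u v => K.
have : `|a| <= 1 by rewrite (le_trans (cauchy_schwarz _ _))// u1 h1 mulr1.
have : `|b| <= 1 by rewrite (le_trans (cauchy_schwarz _ _))// v1 h1 mulr1.
rewrite !ler_norml => /andP[b1 b2] /andP[a1 a2].
have : 0 <= (c - a * b) ^+ 2 by exact: sqr_ge0.
have : 0 <= ((1 - a) * (1 + a)) * ((1 - b) * (1 + b)).
  by rewrite !mulr_ge0//; lra.
move: K; nra.
Qed.

End inner_product_theory.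

(** * Borel measurability in a separable space *)

Lemma separable_seq (R : realType) (H : normedModType R) :
  separable_space H ->
  exists s : nat -> H, forall x (e : R), 0 < e -> exists n, `|x - s n| < e.
Proof.
move=> [D cD dD].
have [g gD] : exists g : nat -> H, set_surj [set: nat] D g.
  exact/pcard_surjP.
exists g => x e e0.
have [y [xy Dy]] : ball x e `&` D !=set0.
  by apply: dD; [exists x; exact: ballxx|exact: ball_open].
have [n _ gn] := gD y Dy.
by exists n; rewrite gn; move: xy; rewrite -ball_normE.
Qed.

Lemma measurable_invr_ge0 d (T : measurableType d) (R : realType) (f : T -> R) :
  (forall x, 0 <= f x) -> measurable_fun setT f ->
  measurable_fun setT (fun x => (f x)^-1).
Proof.
move=> f0 mf; rewrite (_ : (fun _ => _) = fun x => f x `^ (-1)).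
  by apply: (measurableT_comp (measurable_powR (-1))) => //.
by apply/funext => x; rewrite powR_inv1.
Qed.

Lemma measurable_sqrtr_ge0 d (T : measurableType d) (R : realType) (f : T -> R) :
  (forall x, 0 <= f x) -> measurable_fun setT f ->
  measurable_fun setT (fun x => Num.sqrt (f x)).
Proof.
move=> f0 mf; rewrite (_ : (fun _ => _) = fun x => f x `^ (2^-1)).
  by apply: (measurableT_comp (measurable_powR (2^-1))).
by apply/funext => x; rewrite powR12_sqrt.
Qed.

Lemma continuous_borel_measurable (R : realType) (H : normedModType R)
    (f : H -> R) :
  continuous f -> measurable_fun setT (f : borelType H -> R).
Proof.
move=> /continuousP cf.
apply: (measurability _ (RGenOInfty.measurableE R)) => // _ [_ [x ->] <-].
rewrite setTI; apply: sub_sigma_algebra; apply: cf.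
exact: interval_open.
Qed.

Section separable_borel.
Context (R : realType) (H : normedModType R) (ip : H -> H -> R).
Hypotheses (ipP : inner_product ip) (sepH : separable_space H).
Context d (T : measurableType d).
Implicit Types (Y Z : T -> borelType H) (a : T -> R) (x : H).

Local Notation borelfun Y := (measurable_fun [set: T] (Y : T -> borelType H)).

Lemma borel_norm Y : borelfun Y -> measurable_fun setT (fun w => `|Y w : H|).
Proof.
move=> mY; apply: (measurableT_comp (continuous_borel_measurable _) mY).
exact: norm_continuous.
Qed.

Lemma borel_dist Y x : borelfun Y ->
  measurable_fun setT (fun w => `|(Y w : H) - x|).
Proof.
move=> mY; have := @continuous_borel_measurable _ _ (fun y : H => `|y - x|).
move=> mx; apply: (measurableT_comp (mx _) mY).
move=> y; apply: (@cvg_norm _ H); apply: cvgB; [exact: cvg_id|exact: cvg_cst].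
Qed.

(** In a separable space an open set is a countable union of balls centred on a dense sequence.
    Measurability of vector operations thus reduces to that of real distances, and the product
    sigma-algebra of H with itself never has to be compared with a Borel one. *)
Lemma borel_of_dist Y :
  (forall x, measurable_fun setT (fun w => `|(Y w : H) - x|)) -> borelfun Y.
Proof.
move=> mY; apply: (measurability _ (erefl (@measurable _ (borelType H)))).
have [s sd] := separable_seq sepH.
move=> _ [U oU <-]; rewrite setTI.
pose B n k : set H := [set y | `|y - s n| < k.+1%:R^-1].
rewrite (_ : _ @^-1` _ =
  \bigcup_n \bigcup_k (if `[< B n k `<=` U >] then Y @^-1` B n k else set0)).
  apply: bigcupT_measurable => n; apply: bigcupT_measurable => k.
  case: ifPn => // _.
  have := mY (s n) measurableT _ (@measurable_itv R `]-oo, (k.+1%:R^-1 : R)[).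
  rewrite setTI; congr measurable; apply/funext => w /=.
apply/seteqP; split => [w /= Uw|w [n _ [k _]]]; last first.
  by case: ifPn => // /asboolP BU /BU.
have /nbhs_ballP[e /= e0 eU] : nbhs (Y w : H) U by exact: open_nbhs_nbhs.
have e20 : 0 < e / 2 by rewrite divr_gt0.
have [k _ kP] := near_infty_natSinv_lt (PosNum e20).
have {}kP : k.+1%:R^-1 < e / 2 by apply: (kP k) => /=.
have k0 : 0 < k.+1%:R^-1 :> R by rewrite invr_gt0.
have [n nP] := sd (Y w) _ k0.
exists n => //; exists k => //; rewrite ifT//.
apply/asboolP => y yB; apply: eU; rewrite -ball_normE/=.
rewrite (_ : (Y w : H) - y = (Y w : H) - s n - (y - s n)); last first.
  by rewrite opprB addrA subrK.
rewrite (le_lt_trans (ler_normB _ _))// [ltRHS]splitr ltrD//.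
  exact: lt_trans kP.
exact: lt_trans kP.
Qed.

Lemma borel_cst x : borelfun (fun=> x).
Proof. exact: measurable_cst. Qed.

(** The distance is the infimum of |Y - s n| + |Z - s n| over a dense sequence, a countable infimum
    in which the two variables are separated. *)
Lemma borel_dist2 Y Z : borelfun Y -> borelfun Z ->
  measurable_fun setT (fun w => `|(Y w : H) - Z w|).
Proof.
move=> mY mZ; have [s sd] := separable_seq sepH.
rewrite (_ : (fun _ => _) = fun w =>
    infs (fun n => `|(Y w : H) - s n| + `|(Z w : H) - s n|) 0%N).
  apply: (@measurable_fun_infs _ _ _ setT
    (fun n w => `|(Y w : H) - s n| + `|(Z w : H) - s n|)) => [w _|n].
    by exists 0 => _ [n _ <-]; rewrite addr_ge0.
  by apply: measurable_funD; exact: borel_dist.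
apply/funext => w; apply/eqP; rewrite eq_le; apply/andP; split.
  apply: lb_le_inf; first by eexists; exists 0%N.
  move=> _ [n _ <-].
  rewrite (_ : (Y w : H) - _ = (Y w : H) - s n - ((Z w : H) - s n)).
    exact: ler_normB.
  by rewrite opprB addrA subrK.
apply/ler_addgt0Pr => e e0.
have e20 : 0 < e / 2 by rewrite divr_gt0.
have [n nP] := sd (Z w) _ e20.
apply: le_trans (_ : `|(Y w : H) - s n| + `|(Z w : H) - s n| <= _).
  apply: ge_inf; first by exists 0 => _ [k _ <-]; rewrite addr_ge0.
  by exists n.
have : `|(Y w : H) - s n| <= `|(Y w : H) - Z w| + `|(Z w : H) - s n|.
  by rewrite (le_trans _ (ler_normD _ _))// addrA subrK.
lra.
Qed.

Lemma borel_sqr_dist2 Y Z : borelfun Y -> borelfun Z ->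
  measurable_fun setT (fun w => `|(Y w : H) - Z w| ^+ 2).
Proof. by move=> mY mZ; exact/measurable_funX/borel_dist2. Qed.

Lemma borel_ip Y Z : borelfun Y -> borelfun Z ->
  measurable_fun setT (fun w => ip (Y w) (Z w)).
Proof.
move=> mY mZ; under eq_fun do rewrite (polarization ipP).
apply: measurable_funM => //; apply: measurable_funB.
  by apply: measurable_funD; exact/measurable_funX/borel_norm.
exact: borel_sqr_dist2.
Qed.


Lemma borelZ a Y : measurable_fun setT a -> borelfun Y ->
  borelfun (fun w => a w *: (Y w : H)).
Proof.
move=> ma mY; apply: borel_of_dist => x.
rewrite (_ : (fun _ => _) = fun w => Num.sqrt
    (a w ^+ 2 * `|Y w : H| ^+ 2 - 2 * (a w * ip (Y w) x) + `|x| ^+ 2)); last first.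
  apply/funext => w; rewrite -[LHS]ger0_norm// -sqrtr_sqr (normBsq ipP) normrZ.
  by rewrite exprMn real_normK ?num_real// (ipZl ipP).
apply: measurable_sqrtr_ge0.
  move=> w; rewrite (_ : _ + _ = `|a w *: (Y w : H) - x| ^+ 2) ?sqr_ge0//.
  by rewrite (normBsq ipP) normrZ exprMn real_normK ?num_real// (ipZl ipP).
apply: measurable_funD => //; apply: measurable_funB.
  by apply: measurable_funM; apply: measurable_funX => //; exact: borel_norm.
apply: measurable_funM => //; apply: measurable_funM => //.
exact: borel_ip (borel_cst x).
Qed.

(** The distance from Y - Z to x is the distance from Y to Z + x, so it is enough to treat
    translations first. *)
Lemma borelB Y Z : borelfun Y -> borelfun Z ->
  borelfun (fun w => (Y w : H) - (Z w : H)).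
Proof.
move=> mY mZ.
have mZx x : borelfun (fun w => (x : H) - (Z w : H)).
  apply: borel_of_dist => y.
  rewrite (_ : (fun _ => _) = fun w => `|(Z w : H) - (x - y)|).
    exact: borel_dist.
  by apply/funext => w; rewrite distrC; congr `|_|; rewrite !opprB addrCA.
have mZx' x : borelfun (fun w => (Z w : H) + x).
  apply: borel_of_dist => y.
  rewrite (_ : (fun _ => _) = fun w => `|(Z w : H) - (y - x)|).
    exact: borel_dist.
  by apply/funext => w; congr `|_|; rewrite !opprB addrA addrAC.
apply: borel_of_dist => x.
rewrite (_ : (fun _ => _) = fun w => `|(Y w : H) - ((Z w : H) + x)|).
  exact: borel_dist2.
by apply/funext => w; rewrite opprD addrA.
Qed.

Lemma borelD Y Z : borelfun Y -> borelfun Z ->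
  borelfun (fun w => (Y w : H) + (Z w : H)).
Proof.
move=> mY mZ; rewrite (_ : (fun _ => _) =
  (fun w => (Y w : H) - ((0 : H) - (Z w : H)))).
  by apply: borelB => //; apply: borelB => //; exact: borel_cst.
by apply/funext => w; rewrite sub0r opprK.
Qed.

Lemma borel_dir Y : borelfun Y -> borelfun (fun w => dir (Y w : H)).
Proof.
move=> mY; rewrite dir.unlock; apply: borelZ => //.
by apply: measurable_invr_ge0 => //; exact: borel_norm.
Qed.

Lemma borel_sum (F : nat -> T -> H) m n :
  (forall k, (m <= k < n)%N -> borelfun (F k)) ->
  borelfun (fun w => \sum_(m <= k < n) F k w).
Proof.
elim: n => [|n IH] mF.
  by under eq_fun do rewrite big_geq//; exact: borel_cst.
have [mn|mn] := leqP m n; last first.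
  by under eq_fun do rewrite big_geq//; exact: borel_cst.
under eq_fun do rewrite big_nat_recr//=.
apply: borelD; last by apply: mF; rewrite mn ltnSn.
by apply: IH => k /andP[mk kn]; apply: mF; rewrite mk ltnW.
Qed.

End separable_borel.

(** * Expectation *)

Section expectation.
Context d (T : measurableType d) (R : realType) (P : probability T R).
Implicit Types (f g : T -> R).

Lemma ae_ex (Q : T -> Prop) : (\forall w \ae P, Q w) -> exists w, Q w.
Proof.
move=> [N [mN PN0 QN]]; apply: contrapT => nQ.
have NT : N = setT.
  by apply/seteqP; split => // w _; apply: QN => Qw; apply: nQ; exists w.
by move: PN0; rewrite NT probability_setT => /eqP; rewrite onee_eq0.
Qed.

Definition intg f := P.-integrable setT (EFin \o f).
Definition Ex f : R := \int[P]_w f w.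

Lemma intg_measurable f : intg f -> measurable_fun setT f.
Proof. by move=> /measurable_int /measurable_EFinP. Qed.

Lemma bounded_intg f (K : R) : measurable_fun setT f ->
  (forall w, `|f w| <= K) -> intg f.
Proof.
move=> mf fK; apply: measurable_bounded_integrable => //.
  by rewrite (le_lt_trans (probability_le1 _ _)) ?ltry.
exists K; split; first exact: num_real.
by move=> x Kx w _; apply: (le_trans (fK w)); exact: ltW.
Qed.

Lemma intg_cst (k : R) : intg (fun=> k).
Proof. exact: (@bounded_intg _ `|k|). Qed.

Lemma intgD f g : intg f -> intg g -> intg (fun w => f w + g w).
Proof. by move=> If Ig; exact: (integrableD _ If Ig). Qed.

Lemma intgB f g : intg f -> intg g -> intg (fun w => f w - g w).
Proof. by move=> If Ig; exact: (integrableB _ If Ig). Qed.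

Lemma intgZ (k : R) f : intg f -> intg (fun w => k * f w).
Proof. by move=> If; exact: (integrableZl _ k If). Qed.

Lemma intg_abs f : intg f -> intg (fun w => `|f w|).
Proof. by move=> If; exact: (integrable_norm If). Qed.

Lemma le_intg f g : measurable_fun setT f -> intg g ->
  (forall w, `|f w| <= g w) -> intg f.
Proof.
move=> mf Ig fg; apply: (le_integrable _ _ _ Ig) => //.
  exact/measurable_EFinP.
by move=> w _ /=; rewrite lee_fin (le_trans (fg w)) ?ler_norm.
Qed.

Lemma Ex_cst (k : R) : Ex (fun=> k) = k.
Proof.
by rewrite /Ex Rintegral_cst//; have /= -> := probability_setT P; rewrite mulr1.
Qed.

Lemma eq_Ex f g : (forall w, f w = g w) -> Ex f = Ex g.
Proof. by move=> fg; apply: eq_Rintegral => w _. Qed.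

Lemma ExD f g : intg f -> intg g -> Ex (fun w => f w + g w) = Ex f + Ex g.
Proof. by move=> If Ig; exact: RintegralD. Qed.

Lemma ExB f g : intg f -> intg g -> Ex (fun w => f w - g w) = Ex f - Ex g.
Proof. by move=> If Ig; exact: RintegralB. Qed.

Lemma ExZ (k : R) f : intg f -> Ex (fun w => k * f w) = k * Ex f.
Proof. by move=> If; exact: RintegralZl. Qed.

Lemma ExN f : intg f -> Ex (fun w => - f w) = - Ex f.
Proof.
by move=> If; rewrite -mulN1r -ExZ//; apply: eq_Ex => w; rewrite mulN1r.
Qed.

Lemma intg_sum (F : nat -> T -> R) m n :
  (forall k, (m <= k < n)%N -> intg (F k)) ->
  intg (fun w => \sum_(m <= k < n) F k w).
Proof.
elim: n => [|n IH] IF.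
  by under [X in intg X]eq_fun do rewrite big_geq//; exact: intg_cst.
have [mn|mn] := leqP m n; last first.
  by under [X in intg X]eq_fun do rewrite big_geq//; exact: intg_cst.
under [X in intg X]eq_fun do rewrite big_nat_recr//=.
apply: intgD; last by apply: IF; rewrite mn ltnSn.
by apply: IH => k /andP[mk kn]; apply: IF; rewrite mk ltnW.
Qed.

Lemma Ex_sum (F : nat -> T -> R) m n :
  (forall k, (m <= k < n)%N -> intg (F k)) ->
  Ex (fun w => \sum_(m <= k < n) F k w) = \sum_(m <= k < n) Ex (F k).
Proof.
elim: n => [|n IH] IF.
  by under eq_Ex do rewrite big_geq//; rewrite Ex_cst big_geq.
have [mn|mn] := leqP m n; last first.
  by under eq_Ex do rewrite big_geq//; rewrite Ex_cst big_geq.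
under eq_Ex do rewrite big_nat_recr//=.
have IF' k : (m <= k < n)%N -> intg (F k).
  by move=> /andP[mk kn]; apply: IF; rewrite mk ltnW.
rewrite ExD ?IH ?big_nat_recr//; first exact: intg_sum.
by apply: IF; rewrite mn ltnSn.
Qed.

Lemma Ex_ge0 f : (forall w, 0 <= f w) -> 0 <= Ex f.
Proof. by move=> f0; apply: Rintegral_ge0. Qed.

Lemma le_Ex f g : intg f -> intg g -> (forall w, f w <= g w) -> Ex f <= Ex g.
Proof. by move=> If Ig fg; apply: le_Rintegral. Qed.

Lemma Ex_norm f : intg f -> `|Ex f| <= Ex (fun w => `|f w|).
Proof. by move=> If; exact: le_normr_Rintegral. Qed.

Lemma Ex_bounded f (K : R) : measurable_fun setT f ->
  (forall w, `|f w| <= K) -> `|Ex f| <= K.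
Proof.
move=> mf fK; have If := bounded_intg mf fK.
rewrite (le_trans (Ex_norm If))// -[leRHS]Ex_cst.
by apply: le_Ex => //; [exact: intg_abs|exact: intg_cst].
Qed.

Lemma ae_eq_Ex f g : measurable_fun setT f -> measurable_fun setT g ->
  (\forall w \ae P, f w = g w) -> Ex f = Ex g.
Proof.
move=> mf mg fg; rewrite /Ex /Rintegral; congr fine.
apply: ae_eq_integral => //; try exact/measurable_EFinP.
by apply: filterS fg => w fgw _; rewrite fgw.
Qed.

Lemma ae_le_Ex f g : intg f -> intg g ->
  (\forall w \ae P, f w <= g w) -> Ex f <= Ex g.
Proof.
move=> If Ig fg; rewrite -subr_ge0 -ExB//.
rewrite (@ae_eq_Ex _ (fun w => `|g w - f w|)).
- exact: Ex_ge0.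
- exact/intg_measurable/intgB.
- exact/intg_measurable/intg_abs/intgB.
- by apply: filterS fg => w fgw; rewrite ger0_norm// subr_ge0.
Qed.

Lemma EFin_Ex f : intg f -> ((Ex f)%:E = \int[P]_w (f w)%:E)%E.
Proof. by move=> If; rewrite /Ex /Rintegral fineK// integrable_fin_num. Qed.

Lemma Ex_eq0 f : intg f -> (forall w, 0 <= f w) -> Ex f = 0 ->
  \forall w \ae P, f w = 0.
Proof.
move=> If f0 Ef0.
have mf : measurable_fun setT (EFin \o f) by exact: measurable_int If.
have /(ae_eq_integral_abs P measurableT mf).1 :
    (\int[P]_(w in setT) `|(EFin \o f) w| = 0)%E.
  under eq_integral do rewrite /= ger0_norm//.
  by rewrite -EFin_Ex// Ef0.
by apply: filterS => w /(_ I) [].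
Qed.

Lemma sqr_Ex_le f : intg f -> intg (fun w => f w ^+ 2) ->
  Ex f ^+ 2 <= Ex (fun w => f w ^+ 2).
Proof.
move=> If If2; set m := Ex f.
have : 0 <= Ex (fun w => (f w - m) ^+ 2) by apply: Ex_ge0 => w; exact: sqr_ge0.
rewrite (@eq_Ex _ (fun w => f w ^+ 2 - (2 * m * f w - m ^+ 2))); last first.
  by move=> w; ring.
have I1 : intg (fun w => 2 * m * f w) by exact: intgZ.
have I2 : intg (fun w => 2 * m * f w - m ^+ 2) by apply: intgB => //; exact: intg_cst.
have Im : intg (fun=> m ^+ 2) by exact: intg_cst.
rewrite (ExB If2 I2) (ExB I1 Im) (ExZ _ If) Ex_cst -/m; nra.
Qed.

(** Passes from inverses in [\bar R], where 0^-1 is infinite, to inverses in R, where it is 0. A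
    finite integral forces f to be nonzero almost everywhere, so nothing is lost. *)
Lemma inve_moment (f : T -> R) (C : R) : measurable_fun setT f ->
  (forall w, 0 <= f w) -> (\int[P]_w ((f w)%:E)^-1 <= C%:E)%E ->
  [/\ intg (fun w => (f w)^-1), Ex (fun w => (f w)^-1) <= C &
      \forall w \ae P, f w != 0].
Proof.
move=> mf f0 fC.
pose g w := (((f w)%:E)^-1)%E.
have g0 w : (0 <= g w)%E.
  by rewrite /g inver; case: ifPn => // _; rewrite lee_fin invr_ge0.
have mi : measurable_fun setT (fun w => (f w)^-1) by exact: measurable_invr_ge0.
have mg : measurable_fun setT g.
  under [X in measurable_fun _ X]eq_fun do rewrite /g inver.
  apply: measurable_fun_ifT => //.
  - exact: measurable_fun_eqr.
  - exact/measurable_EFinP.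
have ig : P.-integrable setT g.
  apply/integrableP; split => //.
  under eq_integral do rewrite gee0_abs//.
  by rewrite (le_lt_trans fC) ?ltry.
have leg w : ((f w)^-1%:E <= g w)%E.
  by rewrite /g inver; case: ifPn => //; rewrite leey.
have ii : intg (fun w => (f w)^-1).
  apply: (le_integrable _ _ _ ig) => //; first exact/measurable_EFinP.
  by move=> w _ /=; rewrite ger0_norm ?invr_ge0// (gee0_abs (g0 w)).
split => //.
  rewrite -lee_fin EFin_Ex// (le_trans _ fC)//.
  apply: ge0_le_integral => //; last exact/measurable_EFinP.
  by move=> w _; rewrite lee_fin invr_ge0.
have := integrable_ae measurableT ig; apply: filterS => w /(_ I).
by rewrite /g inver; case: ifPn.
Qed.

End expectation.

(** * Freezing an independent variable *)

Definition independent_rvs d d1 d2 (T : measurableType d)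
    (S1 : measurableType d1) (S2 : measurableType d2) (R : realType)
    (P : probability T R) (U : T -> S1) (V : T -> S2) :=
  forall A B, measurable A -> measurable B ->
    P (U @^-1` A `&` V @^-1` B) = (P (U @^-1` A) * P (V @^-1` B))%E.

Section freezing.
Context d d1 d2 (T : measurableType d) (S1 : measurableType d1)
  (S2 : measurableType d2) (R : realType) (P : probability T R).
Implicit Types (f : S1 * S2 -> R).

Lemma bounded_intg_pushforward (V : {RV P >-> S2}) (g : S2 -> R) K :
  measurable_fun setT g -> (forall y, `|g y| <= K) ->
  Ex (distribution P V) g = Ex P (g \o V).
Proof.
move=> mg gK; rewrite /Ex /Rintegral integral_distribution//.
  exact/measurable_EFinP.
apply: (@bounded_intg _ _ _ _ _ K) => //.
exact: measurableT_comp.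
Qed.

Lemma same_law_Ex (V W : {RV P >-> S2}) (g : S2 -> R) K : same_law V W ->
  measurable_fun setT g -> (forall y, `|g y| <= K) ->
  Ex P (fun w => g (V w)) = Ex P (fun w => g (W w)).
Proof.
move=> VW mg gK.
rewrite -[LHS](bounded_intg_pushforward _ mg gK).
rewrite -[RHS](bounded_intg_pushforward _ mg gK).
congr fine; apply: eq_measure_integral => A mA _; exact: VW.
Qed.

Variables (U : {RV P >-> S1}) (V : {RV P >-> S2}).
Hypothesis UV : independent_rvs P U V.

Let m1 : probability S1 R := distribution P U.
Let m2 : probability S2 R := distribution P V.

Let fubini_FE f K : measurable_fun setT f -> (forall y, `|f y| <= K) ->
  fubini_F m2 (EFin \o f) = EFin \o (fun x => Ex P (fun w => f (x, V w))).
Proof.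
move=> mf fK; apply/funext => x; rewrite /= /fubini_F.
have mfx : measurable_fun setT (fun y => f (x, y)) by exact: measurable_fun_pair2.
have IV : intg P (fun w => f (x, V w)).
  apply: (@bounded_intg _ _ _ _ _ K) => //.
  exact: (measurableT_comp mfx).
by rewrite EFin_Ex// /m2 integral_distribution//; exact/measurable_EFinP.
Qed.

Lemma measurable_freezing f K : measurable_fun setT f ->
  (forall y, `|f y| <= K) ->
  measurable_fun setT (fun x => Ex P (fun w => f (x, V w))).
Proof.
move=> mf fK.
have If : (m1 \x m2)%E.-integrable setT (EFin \o f).
  by apply: (@bounded_intg _ _ _ (m1 \x m2)%E _ K).
have := measurable_fubini_F If; rewrite (fubini_FE mf fK) => /measurable_EFinP.
exact.
Qed.

(** Independence identifies the law of the pair with the product of the laws, since both agree on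
    rectangles; Fubini then integrates out V first. *)
Lemma freezing f K : measurable_fun setT f -> (forall y, `|f y| <= K) ->
  Ex P (fun w => f (U w, V w)) =
  Ex P (fun w => Ex P (fun w' => f (U w, V w'))).
Proof.
move=> mf fK.
have If : (m1 \x m2)%E.-integrable setT (EFin \o f).
  by apply: (@bounded_intg _ _ _ (m1 \x m2)%E _ K).
have mW : measurable_fun setT (fun w => (U w, V w)) by exact: measurable_fun_pair.
pose W : {RV P >-> (S1 * S2)%type} :=
  MeasurableFun.Pack (MeasurableFun.Class (isMeasurableFun.Build _ _ _ _ _ mW)).
have -> : Ex P (fun w => f (U w, V w)) = fine (\int[m1 \x m2]_z (f z)%:E)%E.
  transitivity (Ex (distribution P W) f).
    rewrite /Ex /Rintegral integral_distribution//; first exact/measurable_EFinP.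
    by apply: (@bounded_intg _ _ _ _ _ K) => //; exact: measurableT_comp.
  congr fine; apply: eq_measure_integral => A mA _; apply/esym.
  by apply: product_measure_unique => // B C mB mC; exact: UV.
rewrite -integral12_prod_meas1//; congr fine.
have mE := measurable_freezing mf fK.
rewrite (fubini_FE mf fK) /m1 integral_distribution//.
  exact/measurable_EFinP.
apply: (@bounded_intg _ _ _ _ _ K) => [|w]; first exact: (measurableT_comp mE).
apply: Ex_bounded => //; apply: (measurableT_comp mf).
exact: measurable_fun_pair.
Qed.

End freezing.

(** * The filtration generated by the sample *)

Section past.
Context d d' (T : measurableType d) (T' : measurableType d') (R : realType)
  (P : probability T R) (Xs : nat -> {RV P >-> T'}).

Definition past_events (n : nat) : set (set T) :=
  [set A | exists2 B : nat -> set T', (forall i, measurable (B i)) &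
     A = \bigcap_(i in [set i | (1 <= i <= n)%N]) (Xs i @^-1` B i)].

(** The type T with the sigma-algebra generated by X_1, ..., X_n, so that being adapted is plain
    [measurable_fun] with source [past n]. *)
Definition past (n : nat) := g_sigma_algebraType (past_events n).

Lemma past_events_setI n : setI_closed (past_events n).
Proof.
move=> _ _ [A mA ->] [B mB ->]; exists (fun i => A i `&` B i).
  by move=> i; exact: measurableI.
by rewrite -bigcapI.
Qed.

Lemma past_events_measurable n A : past_events n A -> measurable A.
Proof.
move=> [B mB ->]; rewrite bigcap_mkcond; apply: bigcapT_measurable => i.
by case: ifP => // _; rewrite -[_ @^-1` _]setTI; exact: measurable_funPT.
Qed.

Lemma past_measurable n (A : set (past n)) : measurable A ->
  measurable (A : set T).
Proof.
apply: smallest_sub; first exact: sigma_algebra_measurable.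
exact: past_events_measurable.
Qed.

Lemma past_subset n (A : set (past n)) : measurable A ->
  measurable (A : set (past n.+1)).
Proof.
apply: sub_sigma_algebra2 => _ [B mB ->].
exists (fun i => if (i <= n)%N then B i else setT); first by move=> i; case: ifP.
apply/seteqP; split => w wB i /= /andP[i1 ni].
  by case: ifPn => // ni'; apply: wB; rewrite /= i1.
by have := wB i; rewrite /= i1 (leq_trans ni)// ni; apply.
Qed.

Lemma past_measurable_fun n d2 (S : measurableType d2) (f : T -> S) :
  measurable_fun setT (f : past n -> S) -> measurable_fun setT f.
Proof. by move=> mf _ B mB; apply: (@past_measurable n); exact: mf. Qed.

Lemma past_measurable_funS n d2 (S : measurableType d2) (f : T -> S) :
  measurable_fun setT (f : past n -> S) ->
  measurable_fun setT (f : past n.+1 -> S).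
Proof. by move=> mf _ B mB; apply: past_subset; exact: mf. Qed.

Lemma past_measurable_last n : measurable_fun setT (Xs n.+1 : past n.+1 -> T').
Proof.
move=> _ B mB; rewrite setTI; apply: sub_sigma_algebra.
exists (fun i => if i == n.+1 then B else setT); first by move=> i; case: ifP.
apply/seteqP; split => w.
  by move=> wB i /= _; case: eqP => // ->.
by move=> /(_ n.+1 _) /=; rewrite ltnSn eqxx; apply.
Qed.

Hypothesis indX : mutually_independent [set n | (1 <= n)%N] Xs.

(** Mutual independence gives the product formula on cylinders, which are stable under intersection;
    the events A satisfying it form a Dynkin system. *)
Lemma independent_past n (A : set (past n)) B : measurable A -> measurable B ->
  P (A `&` Xs n.+1 @^-1` B) = (P A * P (Xs n.+1 @^-1` B))%E.
Proof.
move=> + mB; have mXB : measurable (Xs n.+1 @^-1` B).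
  by rewrite -[_ @^-1` _]setTI; exact: measurable_funPT.
set C := Xs n.+1 @^-1` B in mXB *.
have PCfin : P C \is a fin_num by exact: fin_num_measure.
move: A; apply: (@dynkin_induction _ (past n) (past_events n)
  (fun A => P (@setI T A C) = (P A * P C)%E) erefl (@past_events_setI n)).
- by rewrite setTI probability_setT mul1e.
- move=> _ [D mD ->].
  pose J : {fset nat} := [fset i in iota 1 n]%fset.
  have Jn : [set` J] = [set i | (1 <= i <= n)%N].
    by apply/seteqP; split => i /=; rewrite !inE mem_iota add1n ltnS.
  have nJ : n.+1 \notin J by rewrite !inE mem_iota add1n ltnn andbF.
  have JS : [set` (n.+1 |` J)%fset] = n.+1 |` [set` J].
    apply/seteqP; split => i /=; first by rewrite in_fset1U => /predU1P.
    by move=> iJ; rewrite in_fset1U; exact/predU1P.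
  pose D' i := if i == n.+1 then B else D i.
  have D'S : forall i, i \in J -> D' i = D i.
    move=> i iJ; rewrite /D'; case: eqP => // iE; by rewrite -iE iJ in nJ.
  have E1 : (P (\bigcap_(i in [set` (n.+1 |` J)%fset]) (Xs i @^-1` D' i)) =
      \prod_(i <- (n.+1 |` J)%fset) P (Xs i @^-1` D' i))%E.
    apply: indX; first by rewrite JS Jn => i [->|/andP[]].
    by move=> i _; rewrite /D'; case: ifP.
  have E2 : (P (\bigcap_(i in [set` J]) (Xs i @^-1` D i)) =
      \prod_(i <- J) P (Xs i @^-1` D i))%E.
    by apply: indX => //; rewrite Jn => i /andP[].
  have E3 : (\prod_(i <- J) P (Xs i @^-1` D' i) =
      \prod_(i <- J) P (Xs i @^-1` D i))%E.
    by rewrite big_seq [RHS]big_seq; apply: eq_bigr => i /D'S ->.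
  move: E1; rewrite JS bigcap_setU1 big_fsetU1//= E3 -E2 Jn.
  have -> : D' n.+1 = B by rewrite /D' eqxx.
  rewrite -/C (muleC _ (P C)) => <-; rewrite setIC; congr (P (_ `&` _)).
  apply: eq_bigcapr => i iJ; rewrite D'S//.
  by have : [set` J] i by rewrite Jn.
- move=> S mS PS.
  have mS' := past_measurable mS.
  have -> : P (@setI T (~` S) C) = (P C - P (@setI T S C))%E.
    rewrite setIC -setDE (setIC (S : set T)); apply: measureD => //.
    by rewrite (le_lt_trans (probability_le1 _ _)) ?ltry.
  rewrite PS probability_setC// muleBl ?mul1e//.
- move=> F mF tF PF.
  have mF' k := past_measurable (mF k).
  have -> : P (@setI T (\bigcup_k F k) C) = (\sum_(k <oo) P (@setI T (F k) C))%E.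
    rewrite setI_bigcupl; apply: measure_semi_bigcup.
    + by move=> k; exact: measurableI.
    + exact: trivIset_setIr.
    + by apply: bigcup_measurable => k _; exact: measurableI.
  have -> : P (\bigcup_k F k) = (\sum_(k <oo) P (F k))%E.
    by apply: measure_semi_bigcup => //; exact: bigcup_measurable.
  rewrite (eq_eseriesr (fun k _ => PF k)).
  rewrite muleC -[P C]fineK// -nneseriesZl//.
  by apply: eq_eseriesr => k _; rewrite muleC.
Qed.

Variable X : {RV P >-> T'}.
Hypothesis lawX : forall n, (1 <= n)%N -> same_law (Xs n) X.

(* Conditioning on the past freezes [w], while [Xs n.+1] becomes a fresh copy of
   [X]; this replaces conditional expectations. *)
Lemma past_freezing n (f : past n * T' -> R) (K : R) : measurable_fun setT f ->
  (forall y, `|f y| <= K) ->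
  Ex P (fun w => f (w, Xs n.+1 w)) =
  Ex P (fun w => Ex P (fun w' => f (w, X w'))).
Proof.
move=> mf fK.
(* The identity, seen as a random variable with values in [past n], carries the whole past at
   once. *)
have mU : measurable_fun setT (id : T -> past n).
  by move=> _ B mB; rewrite setTI; apply: (@past_measurable n).
pose U : {RV P >-> past n} :=
  MeasurableFun.Pack (MeasurableFun.Class (isMeasurableFun.Build _ _ _ _ _ mU)).
have UV : independent_rvs P U (Xs n.+1) by move=> A B mA mB; exact: independent_past.
rewrite (freezing UV mf fK); apply: eq_Ex => w.
apply: (@same_law_Ex _ _ _ _ _ _ _ _ (fun y => f (w, y)) K) => //.
  exact: lawX.
exact: (measurable_fun_pair2 (w : past n) mf).
Qed.

Lemma past_freezing_measurable n (f : past n * T' -> R) (K : R) :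
  measurable_fun setT f -> (forall y, `|f y| <= K) ->
  measurable_fun setT (fun w : past n => Ex P (fun w' => f (w, X w'))).
Proof.
move=> mf fK.
have mU : measurable_fun setT (id : T -> past n).
  by move=> _ B mB; rewrite setTI; apply: (@past_measurable n).
pose U : {RV P >-> past n} :=
  MeasurableFun.Pack (MeasurableFun.Class (isMeasurableFun.Build _ _ _ _ _ mU)).
exact: (measurable_freezing U X mf fK).
Qed.

End past.

(** * The gradient of the median objective *)

Lemma variance_ae_cst d (T : measurableType d) (R : realType)
    (P : probability T R) (Y : T -> R) (c : R) : measurable_fun setT Y ->
  (\forall w \ae P, Y w = c) -> 'V_P[Y] = 0%E.
Proof.
move=> mY Yc.
have EY : ('E_P[Y] = c%:E)%E.
  rewrite unlock -[RHS](expectation_cst P) unlock.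
  apply: ae_eq_integral => //; try exact/measurable_EFinP.
  by apply: filterS Yc => w -> _.
rewrite /variance covariance.unlock EY /=.
transitivity ('E_P[fun w => (Y w - c) * (Y w - c)]%R)%E; first by [].
transitivity ('E_P[cst 0%R]%E); last exact: expectation_cst.
rewrite unlock; apply: ae_eq_integral => //.
- by apply/measurable_EFinP/measurable_funM => //; exact: measurable_funB.
- exact/measurable_EFinP.
- by apply: filterS Yc => w -> _; rewrite subrr mulr0.
Qed.

Section median_analysis.
Context (R : realType) (H : completeNormedModType R) (ip : H -> H -> R).
Hypotheses (ipP : inner_product ip) (sepH : separable_space H).
Context d (T : measurableType d) (P : probability T R).
Variables (X : {RV P >-> borelType H}) (m : H).
Hypothesis nondegX : forall h : H, exists h' : H,
  ip h h' = 0 /\ (0 < 'V_P[fun w => ip (X w : H) h'])%E.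
Variable C : R.
Hypothesis C_gt0 : 0 < C.
Hypothesis invX : forall h : H,
    (\int[P]_w (`|(X w : H) - h|%R%:E)^-1 <= C%:E)%E /\
    (\int[P]_w ((`|(X w : H) - h| ^+ 2)%R%:E)^-1 <= C%:E)%E.
Hypothesis medX : geometric_median X m.
Implicit Types (z v e h : H).

Let mX : measurable_fun setT (X : T -> borelType H).
Proof. exact: measurable_funPT. Qed.

(** If all coordinates of X orthogonal to h are almost surely constant, X lives on a line of
    direction h (on a point when h = 0), against the nondegeneracy assumption. *)
Lemma not_on_line h :
  ~ (forall h', ip h h' = 0 ->
      exists c, \forall w \ae P, ip (X w : H) h' = c).
Proof.
move=> line; have [h' [hh']] := nondegX h.
have [c Xc] := line _ hh'.
rewrite (variance_ae_cst _ Xc) ?ltxx//.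
exact: (borel_ip ipP sepH mX (borel_cst h')).
Qed.

Lemma not_on_ray z b : ~ (\forall w \ae P, dir ((X w : H) - z) = b).
Proof.
move=> ray; apply: (@not_on_line b) => h' bh'; exists (ip z h').
apply: filterS ray => w Xb.
apply/eqP; rewrite -subr_eq0 -(ipBl ipP) [X in ip X _]dirE Xb.
by rewrite (ipZl ipP) bh' mulr0.
Qed.

Lemma mdir z : measurable_fun setT (fun w => dir ((X w : H) - z) : borelType H).
Proof. exact: (borel_dir ipP sepH (borelB sepH mX (borel_cst z))). Qed.

Lemma mip_dir z e : measurable_fun setT (fun w => ip (dir ((X w : H) - z)) e).
Proof. exact: (borel_ip ipP sepH (mdir z) (borel_cst e)). Qed.

Lemma intg_ip_dir z e : intg P (fun w => ip (dir ((X w : H) - z)) e).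
Proof.
apply: (@bounded_intg _ _ _ _ _ `|e|); first exact: mip_dir.
by move=> w; exact: (ip_dir_le ipP).
Qed.

Lemma invX1 z :
  [/\ intg P (fun w => `|(X w : H) - z|^-1),
      Ex P (fun w => `|(X w : H) - z|^-1) <= C &
      \forall w \ae P, (X w : H) - z != 0].
Proof.
have [i1 i2 i3] := inve_moment (borel_dist z mX) (fun w => normr_ge0 _) (invX z).1.
by split=> //; apply: filterS i3 => w; rewrite normr_eq0.
Qed.

Lemma invX2 z :
  intg P (fun w => `|(X w : H) - z| ^- 2) /\
  Ex P (fun w => `|(X w : H) - z| ^- 2) <= C.
Proof.
have m2 : measurable_fun setT (fun w => `|(X w : H) - z| ^+ 2).
  exact/measurable_funX/borel_dist.
by have [] := inve_moment m2 (fun w => sqr_ge0 _) (invX z).2.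
Qed.

(** Tested against e, the mean unit step of the recursion when the current point is z. *)
Definition phi e z : R := Ex P (fun w => ip (dir ((X w : H) - z)) e).

Lemma phi_le e z : `|phi e z| <= `|e|.
Proof.
apply: Ex_bounded; first exact: mip_dir.
by move=> w; exact: (ip_dir_le ipP).
Qed.

Lemma dir_shift_lipschitz z z' e w : (X w : H) - z != 0 ->
  `|ip (dir ((X w : H) - z)) e - ip (dir ((X w : H) - z')) e|
   <= 2 * `|z - z'| * `|e| * `|(X w : H) - z|^-1.
Proof.
move=> Xz; rewrite -(ipBl ipP) (le_trans (cauchy_schwarz ipP _ _))//.
have := @dir_lipschitz R H _ ((X w : H) - z') Xz.
have -> : (X w : H) - z - ((X w : H) - z') = z' - z.
  by rewrite opprB addrC addrA subrK.
rewrite (distrC z') => /(ler_wpM2r (normr_ge0 e)) /le_trans -> //.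
by rewrite le_eqVlt; apply/orP; left; apply/eqP; ring.
Qed.

Lemma phi_lipschitz e z z' :
  `|phi e z - phi e z'| <= 2 * C * `|z - z'| * `|e|.
Proof.
have [i1 EC ne0] := invX1 z.
have Id := intg_ip_dir.
rewrite /phi -ExB// (le_trans (Ex_norm _))//; first exact: intgB.
apply: le_trans (_ : Ex P (fun w => 2 * `|z - z'| * `|e| * `|(X w : H) - z|^-1) <= _).
  apply: ae_le_Ex; [exact/intg_abs/intgB|exact: intgZ|].
  by apply: filterS ne0 => w; exact: dir_shift_lipschitz.
rewrite ExZ//.
have : 0 <= 2 * `|z - z'| * `|e| by rewrite !mulr_ge0.
by move/ler_wpM2l => /(_ _ _ EC); lra.
Qed.

Lemma intg_objective z : intg P (fun w => `|(X w : H) - z| - `|X w : H|).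
Proof.
apply: (@bounded_intg _ _ _ _ _ `|z|) => [|w].
  apply: measurable_funB; last exact: (borel_norm mX).
  exact: (borel_dist _ mX).
have := ler_dist_dist ((X w : H) - z) (X w).
by rewrite addrAC subrr add0r normrN.
Qed.

(** Minimality of m is combined with the subgradient inequality taken at m + t e, so the objective
    is never differentiated under the integral. Letting t tend to 0 by the Lipschitz bound, then
    changing e into -e, gives [phi_median]. *)
Lemma phi_le0 e (t : R) : 0 < t -> phi e (m + t *: e) <= 0.
Proof.
move=> t0; have := medX (m + t *: e).
rewrite /median_objective unlock -!EFin_Ex ?lee_fin; try exact: intg_objective.
rewrite -subr_ge0 -ExB; try exact: intg_objective.
move=> G0; rewrite -(pmulr_rle0 _ t0) -oppr_ge0 (le_trans G0)//.
rewrite /phi -ExZ -?ExN; [|exact/intgZ/intg_ip_dir|exact: intg_ip_dir].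
apply: le_Ex.
- by apply: intgB; exact: intg_objective.
- have := intgZ (-1) (intgZ t (intg_ip_dir (m + t *: e) e)).
  by congr intg; apply/funext => w; rewrite mulN1r.
move=> w; have := norm_subgradient ipP ((X w : H) - (m + t *: e)) (t *: e).
have -> : (X w : H) - (m + t *: e) + t *: e = (X w : H) - m.
  by rewrite opprD addrA subrK.
rewrite (ipZr ipP); lra.
Qed.

Lemma phi_median_le0 e : phi e m <= 0.
Proof.
apply/ler_addgt0Pr => eps eps0; rewrite add0r.
(* With t = eps / K the Lipschitz error 2 C t |e|^2 is below eps; the added 1 keeps K positive when
   e = 0. *)
pose K := 2 * C * `|e| * `|e| + 1.
have K0 : 0 < K by rewrite ltr_wpDl// !mulr_ge0// ltW.
have t0 : 0 < eps / K by rewrite divr_gt0.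
have := phi_lipschitz e m (m + (eps / K) *: e).
rewrite opprD addrA subrr add0r normrN normrZ (gtr0_norm t0) ler_norml.
move=> /andP[_]; rewrite lerBlDr => /le_trans -> //.
rewrite (le_trans (lerD (lexx _) (phi_le0 e t0)))// addr0.
have -> : 2 * C * (eps / K * `|e|) * `|e| = eps * ((K - 1) / K).
  by rewrite /K; field; rewrite gt_eqF.
apply: ler_piMr; first exact: ltW.
by rewrite ler_pdivrMr// mul1r gerBl.
Qed.

Lemma phiN e z : phi (- e) z = - phi e z.
Proof.
rewrite /phi -ExN; last exact: intg_ip_dir.
by apply: eq_Ex => w; rewrite (ipNr ipP).
Qed.

Lemma phi_median e : phi e m = 0.
Proof.
apply/eqP; rewrite eq_le phi_median_le0 -oppr_le0 -phiN; exact: phi_median_le0.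
Qed.

(* [- phi] is the gradient of the median objective and [hess] its Hessian at
   [m]. *)
Definition hess v e : R := Ex P (fun w => `|(X w : H) - m|^-1 *
  (ip v e - ip (dir ((X w : H) - m)) v * ip (dir ((X w : H) - m)) e)).

Lemma hess_integrand_le v e w :
  `| `|(X w : H) - m|^-1 * (ip v e - ip (dir ((X w : H) - m)) v *
      ip (dir ((X w : H) - m)) e)|
  <= 2 * (`|v| * `|e|) * `|(X w : H) - m|^-1.
Proof.
rewrite normrM ger0_norm ?invr_ge0// mulrC ler_wpM2r ?invr_ge0//.
rewrite (le_trans (ler_normB _ _))// mulr_natl mulr2n lerD//.
  exact: (cauchy_schwarz ipP).
by rewrite normrM ler_pM//; exact: (ip_dir_le ipP).
Qed.

Lemma intg_hess v e : intg P (fun w => `|(X w : H) - m|^-1 *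
  (ip v e - ip (dir ((X w : H) - m)) v * ip (dir ((X w : H) - m)) e)).
Proof.
have [i1 _ _] := invX1 m.
apply: (le_intg _ (intgZ (2 * (`|v| * `|e|)) i1)).
  apply: measurable_funM; first exact: intg_measurable i1.
  by apply: measurable_funB => //; apply: measurable_funM; exact: mip_dir.
by move=> w; exact: hess_integrand_le.
Qed.

Lemma hess_bound v e : `|hess v e| <= 2 * C * `|v| * `|e|.
Proof.
have [i1 EC _] := invX1 m.
rewrite (le_trans (Ex_norm (intg_hess _ _)))//.
apply: le_trans (_ : Ex P (fun w => 2 * (`|v| * `|e|) * `|(X w : H) - m|^-1) <= _).
  by apply: le_Ex; [exact/intg_abs/intg_hess|exact: intgZ|exact: hess_integrand_le].
rewrite ExZ//.
have : 0 <= 2 * (`|v| * `|e|) by rewrite !mulr_ge0.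
by move/ler_wpM2l => /(_ _ _ EC); lra.
Qed.

Lemma hessD v v' e : hess (v + v') e = hess v e + hess v' e.
Proof.
rewrite /hess -ExD; [|exact: intg_hess..].
by apply: eq_Ex => w; rewrite !(ipDl ipP, ipDr ipP); ring.
Qed.

Lemma hessZ a v e : hess (a *: v) e = a * hess v e.
Proof.
rewrite /hess -ExZ; last exact: intg_hess.
by apply: eq_Ex => w; rewrite !(ipZl ipP, ipZr ipP); ring.
Qed.

Lemma hess_sum (F : nat -> H) i j e :
  hess (\sum_(i <= k < j) F k) e = \sum_(i <= k < j) hess (F k) e.
Proof.
elim: (index_iota i j) => [|k s IH]; last by rewrite !big_cons hessD IH.
by rewrite !big_nil -(scale0r 0) hessZ mul0r.
Qed.

Lemma hessC v e : hess v e = hess e v.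
Proof. by apply: eq_Ex => w; rewrite (ipC ipP v); ring. Qed.

Lemma hess_sqrD a b : hess (a + b) (a + b) = hess a a + 2 * hess a b + hess b b.
Proof. by rewrite hessD !(hessC _ (a + b)) !hessD (hessC b a); ring. Qed.

(** [dir_expansion_ip] integrated, using that [phi e] vanishes at m. This is where the second
    inverse moment enters. *)
Lemma phi_expansion v e :
  `|phi e (m + v) + hess v e| <= 4 * C * `|v| ^+ 2 * `|e|.
Proof.
have [i1 _ ne0] := invX1 m; have [i2 EC] := invX2 m.
have Id := intg_ip_dir; have Ih := intg_hess v e.
rewrite -[phi _ _]subr0 -(phi_median e) /phi /hess -ExB// -ExD//; last exact: intgB.
have I0 : intg P (fun w => ip (dir ((X w : H) - (m + v))) e -
    ip (dir ((X w : H) - m)) e +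
    `|(X w : H) - m|^-1 * (ip v e -
      ip (dir ((X w : H) - m)) v * ip (dir ((X w : H) - m)) e)).
  by apply: intgD => //; exact: intgB.
rewrite (le_trans (Ex_norm I0))//.
apply: le_trans (_ : Ex P (fun w => 4 * `|v| ^+ 2 * `|e| * `|(X w : H) - m| ^- 2) <= _).
  apply: ae_le_Ex; [exact/intg_abs|exact: intgZ|].
  apply: filterS ne0 => w Xm.
  by rewrite opprD addrA; exact: dir_expansion_ip.
rewrite ExZ//.
have : 0 <= 4 * `|v| ^+ 2 * `|e| by rewrite !mulr_ge0.
by move/ler_wpM2l => /(_ _ _ EC); lra.
Qed.

Lemma phi_monotone z z' : phi (z' - z) z' <= phi (z' - z) z.
Proof.
apply: le_Ex; [exact: intg_ip_dir..|move=> w].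
have := dir_monotone ipP ((X w : H) - z) ((X w : H) - z').
have -> : (X w : H) - z - ((X w : H) - z') = z' - z.
  by rewrite opprB addrC addrA subrK.
by rewrite (ipBl ipP) subr_ge0.
Qed.

(** Second moment of the e-coordinate of a unit step from z. At m the mean of that coordinate is
    zero, so [psi e m] is the limiting variance of the noise. *)
Definition psi e z : R := Ex P (fun w => ip (dir ((X w : H) - z)) e ^+ 2).

Lemma intg_sqr_ip_dir z e : intg P (fun w => ip (dir ((X w : H) - z)) e ^+ 2).
Proof.
apply: (@bounded_intg _ _ _ _ _ (`|e| ^+ 2)); first exact/measurable_funX/mip_dir.
by move=> w; rewrite normrX lerXn2r ?nnegrE//; exact: (ip_dir_le ipP).
Qed.

Lemma psi_le e z : `|psi e z| <= `|e| ^+ 2.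
Proof.
apply: Ex_bounded; first exact/measurable_funX/mip_dir.
by move=> w; rewrite ger0_norm ?sqr_ge0// (ip_dir_sqr_le ipP).
Qed.

Lemma psi_lipschitz e z z' :
  `|psi e z - psi e z'| <= 4 * C * `|z - z'| * `|e| ^+ 2.
Proof.
have [i1 EC ne0] := invX1 z.
have Id := intg_sqr_ip_dir.
rewrite /psi -ExB// (le_trans (Ex_norm _))//; first exact: intgB.
apply: le_trans (_ : Ex P (fun w =>
    4 * `|z - z'| * `|e| ^+ 2 * `|(X w : H) - z|^-1) <= _).
  apply: ae_le_Ex; [exact/intg_abs/intgB|exact: intgZ|].
  apply: filterS ne0 => w /(@dir_shift_lipschitz z z' e) L.
  rewrite subr_sqr normrM.
  apply: le_trans (ler_pM _ _ L (_ : _ <= 2 * `|e|)) _ => //.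
    rewrite (le_trans (ler_normD _ _))// mulr_natl mulr2n lerD//; exact: (ip_dir_le ipP).
  by rewrite le_eqVlt; apply/orP; left; apply/eqP; ring.
rewrite ExZ//.
have : 0 <= 4 * `|z - z'| * `|e| ^+ 2 by rewrite !mulr_ge0 ?exprn_ge0.
by move/ler_wpM2l => /(_ _ _ EC); lra.
Qed.

Lemma psi_gt0 : exists e, 0 < psi e m.
Proof.
apply: contrapT => npos; apply: (@not_on_line 0) => e _; exists (ip m e).
have psi0 : psi e m = 0.
  apply/eqP; rewrite eq_le Ex_ge0 ?andbT => [|w]; last exact: sqr_ge0.
  by rewrite leNgt; apply/negP => pe; apply: npos; exists e.
have := Ex_eq0 (intg_sqr_ip_dir m e) (fun w => sqr_ge0 _) psi0.
apply: filterS => w /eqP; rewrite sqrf_eq0 => /eqP d0.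
apply/eqP; rewrite -subr_eq0 -(ipBl ipP) [X in ip X _]dirE.
by rewrite (ipZl ipP) d0 mulr0.
Qed.

Let invY_ge0 w : 0 <= `|(X w : H) - m|^-1. Proof. by rewrite invr_ge0. Qed.

Lemma hess_ge0 h : 0 <= hess h h.
Proof.
apply: Ex_ge0 => w; rewrite mulr_ge0// subr_ge0 (ipxx ipP) -expr2.
exact: (ip_dir_sqr_le ipP).
Qed.

(** Needed in [hess_coercive], where the quadratic form is evaluated at a random direction and
    integrated. *)
Lemma measurable_hess_diag : measurable_fun setT (fun h : borelType H => hess h h).
Proof.
apply: continuous_borel_measurable => h.
apply/cvgrPdist_lt => e e0.
pose K := 2 * C * (1 + 2 * `|h|) + 1.
have K0 : 0 < K by rewrite ltr_wpDl// !mulr_ge0 ?addr_ge0 ?mulr_ge0// ltW.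
have d0 : 0 < Num.min 1 (e / K) by rewrite lt_min ltr01 divr_gt0.
near=> g.
have : `|g - h| < Num.min 1 (e / K).
  rewrite distrC; near: g; apply/nbhs_ballP.
  by exists (Num.min 1 (e / K)) => //= g; rewrite -ball_normE.
rewrite lt_min => /andP[gh1]; rewrite ltr_pdivlMr// => ghK.
have -> : hess h h - hess g g = - (hess (g - h) (g - h) + 2 * hess (g - h) h).
  by have := hess_sqrD (g - h) h; rewrite subrK => ->; ring.
rewrite normrN (le_lt_trans (ler_normD _ _))// normrM ger0_norm//.
have B1 := hess_bound (g - h) (g - h); have B2 := hess_bound (g - h) h.
apply: le_lt_trans ghK; rewrite /K.
have : `|g - h| * `|g - h| <= `|g - h| by rewrite ler_piMr// ltW.
move=> /(ler_wpM2l (ltW C_gt0)); have := normr_ge0 (g - h).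
move: B1 B2; lra.
Unshelve. all: by end_near.
Qed.

(* Averaging [unit_angle] over two independent copies of [X] bounds the quadratic
   form from below without any compactness argument: a constant independent of
   [h] remains, which vanishes only if [X] is supported by a line through [m]. *)
Lemma hess_coercive : exists2 c : R, 0 < c &
  forall h, c * `|h| ^+ 2 <= hess h h.
Proof.
have [i1 EC ne0] := invX1 m.
pose u w := dir ((X w : H) - m).
(* The quadratic form at the direction of one copy of X, weighted by its inverse distance to m; its
   mean is the constant that remains. *)
pose J w := `|(X w : H) - m|^-1 * hess (u w) (u w).
have J0 w : 0 <= J w by rewrite mulr_ge0// hess_ge0.
have IJ : intg P J.
  apply: (le_intg _ (intgZ (2 * C) i1)) => [|w].
    apply: measurable_funM; first exact: intg_measurable i1.
    exact: (measurableT_comp measurable_hess_diag (mdir m)).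
  rewrite ger0_norm// /J mulrC ler_wpM2r//.
  rewrite (le_trans (ler_norm _))// (le_trans (hess_bound _ _))//.
  rewrite -mulrA; apply: ler_piMr; first by rewrite mulr_ge0 ?ltW.
  by rewrite mulr_ile1 ?norm_dir_le1.
have EJ_gt0 : 0 < Ex P J.
  rewrite lt0r Ex_ge0// andbT; apply/eqP => EJ0.
  (* A single outcome with vanishing J is enough: the form vanishes at [u w], so almost every
     direction is parallel to [u w] and X lies on one line through m. *)
  have [w [Jw w0]] : exists w, J w = 0 /\ (X w : H) - m != 0.
    have : \forall w \ae P, J w = 0 /\ (X w : H) - m != 0.
      by apply: filterS2 (Ex_eq0 IJ J0 EJ0) ne0.
    exact: ae_ex.
  have uw : `|u w| = 1 by exact: norm_dir.
  have hw : hess (u w) (u w) = 0.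
    move/eqP: Jw; rewrite /J mulf_eq0 invr_eq0 normr_eq0 (negbTE w0).
    by move/eqP.
  apply: (@not_on_line (u w)) => h' uh'; exists (ip m h').
  have I0 w' : 0 <= `|(X w' : H) - m|^-1 *
      (ip (u w) (u w) - ip (u w') (u w) * ip (u w') (u w)).
    rewrite mulr_ge0// subr_ge0 (ipxx ipP) -expr2.
    exact: (ip_dir_sqr_le ipP).
  apply: filterS2 (Ex_eq0 (intg_hess (u w) (u w)) I0 hw) ne0 => w' + w'0.
  move=> /eqP; rewrite mulf_eq0 invr_eq0 normr_eq0 (negbTE w'0) /= => /eqP.
  rewrite (ipxx ipP) uw expr1n -/(u w') => a1.
  have uw' : `|u w'| = 1 by exact: norm_dir.
  have u0 : u w' = ip (u w') (u w) *: u w.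
    apply/eqP; rewrite -subr_eq0 -normr_eq0 -sqrf_eq0 (normBsq ipP).
    rewrite (normrZ (ip _ _)) uw uw'.
    rewrite (ipZr ipP) mulr1 real_normK ?num_real//; apply/eqP.
    by move: a1; set a := ip _ _; lra.
  apply/eqP; rewrite -subr_eq0 -(ipBl ipP) [X in ip X _]dirE -/(u w') u0.
  by rewrite !(ipZl ipP) uh' !mulr0.
have unit_case h : `|h| = 1 -> Ex P J <= 4 * C * hess h h.
  move=> h1.
  have Ih := intg_hess h h.
  have -> : 4 * C * hess h h = 2 * hess h h * C + 2 * C * hess h h by ring.
  apply: le_trans (_ : Ex P (fun w => 2 * hess h h * `|(X w : H) - m|^-1 +
     2 * C * (`|(X w : H) - m|^-1 * (ip h h - ip (u w) h * ip (u w) h))) <= _); last first.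
    rewrite ExD ?ExZ//; try exact: intgZ.
    by rewrite lerD// ler_wpM2l// mulr_ge0// hess_ge0.
  apply: le_Ex => // [|w]; first by apply: intgD; exact: intgZ.
  rewrite /J; have [w0|w0] := eqVneq ((X w : H) - m) 0.
    by rewrite w0 normr0 invr0 !(mul0r, mulr0) addr0.
  have uw : `|u w| = 1 by exact: norm_dir.
  (* For fixed w, [unit_angle] is integrated over the other copy w' with weight 1/|X w' - m|; the
     term in w alone picks up the factor C. *)
  have : hess (u w) (u w) <= 2 * hess h h + 2 * C * (ip h h - ip (u w) h * ip (u w) h).
    apply: le_trans (_ : Ex P (fun w' => 2 * (`|(X w' : H) - m|^-1 *
       (ip h h - ip (u w') h * ip (u w') h)) +
       2 * (1 - ip (u w) h ^+ 2) * `|(X w' : H) - m|^-1) <= _).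
      apply: ae_le_Ex; [exact: intg_hess|by apply: intgD; exact: intgZ|].
      apply: filterS ne0 => w' w'0.
      have uw' : `|u w'| = 1 by exact: norm_dir.
      have := unit_angle ipP uw' uw h1.
      rewrite !(ipxx ipP) uw h1 expr1n -!expr2 -/(u w') => A.
      have := ler_wpM2l (invY_ge0 w') A; lra.
    rewrite ExD ?ExZ//; try exact: intgZ.
    rewrite -/(hess h h) lerD2l (ipxx ipP) h1 expr1n -expr2.
    have a1 : 0 <= 1 - ip (u w) h ^+ 2.
      by rewrite subr_ge0; have := ip_dir_sqr_le ipP ((X w : H) - m) h; rewrite h1 expr1n.
    by have := ler_wpM2l a1 EC; lra.
  move=> /(ler_wpM2l (invY_ge0 w)); lra.
exists (Ex P J / (4 * C)); first by rewrite divr_gt0// mulr_gt0.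
move=> h; have [->|h0] := eqVneq h 0; first by rewrite normr0 expr0n mulr0 hess_ge0.
have U := unit_case _ (norm_dir h0).
have -> : hess h h = `|h| ^+ 2 * hess (dir h) (dir h).
  by rewrite {1 2}(dirE h) hessZ hessC hessZ mulrA expr2.
rewrite [leLHS]mulrC ler_wpM2l ?sqr_ge0//.
by rewrite ler_pdivrMr ?mulr_gt0// mulrC.
Qed.

(* [phi h (m + t h)] is nonincreasing in [t], so that the quadratic lower bound
   given near [m] by the Hessian propagates linearly to the whole ray. *)
Lemma median_drift : exists2 c : R, 0 < c &
  forall v, c * `|v| ^+ 2 <= - phi v (m + v) * Num.sqrt (1 + `|v| ^+ 2).
Proof.
have [c c0 hc] := hess_coercive.
(* For |v| at most t0 the cubic error 4 C |v|^3 is at most half of the quadratic lower bound c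
   |v|^2. *)
pose t0 := Num.min 1 (c / (8 * C)).
have C8 : 0 < 8 * C by rewrite mulr_gt0.
have t00 : 0 < t0 by rewrite lt_min ltr01 divr_gt0.
have t01 : t0 <= 1 by rewrite ge_min lexx.
have t0c : t0 * (8 * C) <= c by rewrite -ler_pdivlMr// ge_min lexx orbT.
have near v : `|v| <= t0 -> c / 2 * `|v| ^+ 2 <= - phi v (m + v).
  move=> vt; have := phi_expansion v v; have := hc v.
  rewrite ler_norml => hv /andP[_ ub].
  have : 4 * C * `|v| ^+ 2 * `|v| <= c / 2 * `|v| ^+ 2.
    rewrite mulrAC ler_wpM2r ?sqr_ge0//.
    have := ler_wpM2l (ltW C8) vt; lra.
  lra.
have far v : t0 < `|v| -> c / 2 * t0 * `|v| <= - phi v (m + v).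
  move=> tv; have v0 : 0 < `|v| by exact: lt_trans tv.
  pose a := t0 / `|v|; have a0 : 0 < a by rewrite divr_gt0.
  have a1 : a < 1 by rewrite ltr_pdivrMr// mul1r.
  have nav : `|a *: v| = t0.
    by rewrite normrZ gtr0_norm// divfK// gt_eqF.
  have phiZ k e z : phi (k *: e) z = k * phi e z.
    rewrite /phi -ExZ; last exact: intg_ip_dir.
    by apply: eq_Ex => w; rewrite (ipZr ipP).
  have := near (a *: v); rewrite nav lexx phiZ => /(_ isT) n1.
  have := phi_monotone (m + a *: v) (m + v).
  have -> : m + v - (m + a *: v) = (1 - a) *: v.
    by rewrite opprD addrACA subrr add0r scalerBl scale1r.
  rewrite !phiZ ler_pM2l ?subr_gt0// => mon.
  have : - phi v (m + a *: v) <= - phi v (m + v) by rewrite lerN2.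
  apply: le_trans; rewrite -(ler_pM2l a0) mulrN; apply: le_trans n1.
  rewrite /a expr2 le_eqVlt; apply/orP; left; apply/eqP; field.
  by rewrite gt_eqF.
exists (c / 2 * t0); first by rewrite !mulr_gt0.
(* The root dominates both 1 and |v|: the former handles the quadratic regime, the latter turns the
   linear bound of [far] into a quadratic one. *)
move=> v; set q := Num.sqrt _.
have q1 : 1 <= q by rewrite -[leLHS]sqrtr1 ler_wsqrtr// lerDl sqr_ge0.
have qv : `|v| <= q.
  by rewrite -[leLHS]normr_id -sqrtr_sqr ler_wsqrtr// lerDr.
have c20 : 0 < c / 2 by rewrite divr_gt0.
have [vt|vt] := leP `|v| t0.
  have D0 := near v vt.
  have n2 : 0 <= c / 2 * `|v| ^+ 2 by rewrite mulr_ge0 ?sqr_ge0// ltW.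
  apply: le_trans (_ : c / 2 * `|v| ^+ 2 <= _).
    by rewrite mulrAC ler_piMr.
  by rewrite (le_trans D0)// ler_peMr// (le_trans n2).
have D0 := far v vt.
have n2 : 0 <= c / 2 * t0 * `|v| by rewrite !mulr_ge0// ltW.
rewrite expr2 mulrA ler_pM//.
Qed.

End median_analysis.

(** * The Lyapunov function *)

Section lyapunov.
Context (R : realType).
Implicit Types (t d g a : R).

(* With [t = |z - m|^2], it is comparable to [t] near [m] and grows exponentially
   at infinity, so that the gradient contracts it by a constant factor although
   the drift towards [m] is only bounded far from [m]. *)
Definition lyap t : R := expR (Num.sqrt (1 + t) - 1).

Lemma sqrt1D_ge1 t : 0 <= t -> 1 <= Num.sqrt (1 + t).
Proof. by move=> t0; rewrite -[leLHS]sqrtr1 ler_wsqrtr// lerDl. Qed.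

(** From exp(a) (1 - a) <= 1 and (1 + a + 2 a^2)(1 - a) = 1 + a^2 (1 - 2 a) >= 1. *)
Lemma expR_le_quad a : a <= 2^-1 -> expR a <= 1 + a + 2 * a ^+ 2.
Proof.
move=> a2; have E : expR a * expR (- a) = 1 by exact: expRxMexpNx_1.
have := expR_ge1Dx (- a); have := expR_gt0 a; move=> e0 e1.
have : expR a * (1 - a) <= 1 by rewrite -[leRHS]E ler_wpM2l// ltW.
have : 1 <= (1 + a + 2 * a ^+ 2) * (1 - a) by nra.
move=> h1 h2; have : expR a * (1 - a) <= (1 + a + 2 * a ^+ 2) * (1 - a) by lra.
by rewrite ler_pM2r//; lra.
Qed.

Lemma lyap_ge1 t : 0 <= t -> 1 <= lyap t.
Proof.
move=> t0; rewrite (le_trans _ (expR_ge1Dx _))// lerDl subr_ge0.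
exact: sqrt1D_ge1.
Qed.

(** With q = sqrt(1 + t), [lyap t] is the square of exp((q - 1)/2), hence at least ((q + 1)/2)^2;
    subtracting 1 leaves (q - 1)(q + 3)/4, at least (q^2 - 1)/4 = t/4. *)
Lemma lyap_ge t : 0 <= t -> t <= 4 * (lyap t - 1).
Proof.
move=> t0; have := sqrt1D_ge1 t0; set q := Num.sqrt _ => q1.
have qE : q ^+ 2 = 1 + t by rewrite sqr_sqrtr// addr_ge0.
have -> : lyap t = expR ((q - 1) / 2) ^+ 2.
  by rewrite /lyap -/q -expRM_natl; congr expR; field.
have := expR_ge1Dx ((q - 1) / 2); set e := expR _ => eq.
have : ((q + 1) / 2) ^+ 2 <= e ^+ 2.
  by rewrite lerXn2r ?nnegrE//; lra.
nra.
Qed.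

(** Divided by [lyap t], the left side is 1 - exp(-(q - 1)), at most both q - 1 and 1, and the right
    side is 2 (1 - 1/q^2). The two bounds serve q <= 2 and q > 2. *)
Lemma lyap_contraction t : 0 <= t -> lyap t - 1 <= 2 * (lyap t * (t / (1 + t))).
Proof.
move=> t0; have := sqrt1D_ge1 t0; set q := Num.sqrt _ => q1.
have qE : q ^+ 2 = 1 + t by rewrite sqr_sqrtr// addr_ge0.
have E : lyap t * expR (- (q - 1)) = 1 by exact: expRxMexpNx_1.
have := expR_ge1Dx (- (q - 1)); have := expR_gt0 (- (q - 1)).
move: E; set x := expR _ => E x0 x1.
have L0 : 0 < lyap t by exact: expR_gt0.
have -> : t / (1 + t) = (q ^+ 2 - 1) / q ^+ 2 by rewrite qE; field; lra.
have q20 : 0 < q ^+ 2 by rewrite qE; lra.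
suff H : 1 - x <= 2 * ((q ^+ 2 - 1) / q ^+ 2).
  have := ler_wpM2l (ltW L0) H; rewrite mulrBr E mulr1; lra.
rewrite mulrA ler_pdivlMr//.
have [q2|q2] := leP q 2.
  have : (1 - x) * q ^+ 2 <= (q - 1) * q ^+ 2 by rewrite ler_pM2r//; lra.
  nra.
have : (1 - x) * q ^+ 2 <= 1 * q ^+ 2 by rewrite ler_pM2r//; lra.
nra.
Qed.

(** One step of size g: d is the inner product of the unit step with Z_n - m. The linear term in d
    is kept exact, to be averaged later. *)
Lemma lyap_step t t' d g : 0 <= t -> 0 <= g <= 4^-1 -> `|d| <= Num.sqrt t ->
  0 <= t' -> t' <= t + 2 * g * d + g ^+ 2 ->
  lyap t' <= lyap t * (1 + 9 * g ^+ 2) + g * (lyap t / Num.sqrt (1 + t) * d).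
Proof.
move=> t0 /andP[g0 g4] dt t'0 tt'.
have := sqrt1D_ge1 t0; rewrite /lyap; set q := Num.sqrt (1 + t) => q1.
have qE : q ^+ 2 = 1 + t by rewrite sqr_sqrtr// addr_ge0.
have q0 : 0 < q by lra.
have : `|d| <= q by rewrite (le_trans dt)// ler_wsqrtr// lerDr.
rewrite ler_norml => /andP[d1 d2].
(* Tangent bound for the square root: sqrt(1 + t') <= q + a. Since -g <= a <= 2 g, the term 2 a^2 is
   at most 8 g^2, and the remaining g^2/2 fits into the constant 9. *)
pose a := (g * d + g ^+ 2 / 2) / q.
have aq : a * q = g * d + g ^+ 2 / 2 by rewrite /a divfK// gt_eqF.
have a1 : - g <= a by rewrite -(ler_pM2r q0) aq; nra.
have a2 : a <= 2 * g by rewrite -(ler_pM2r q0) aq; nra.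
have : Num.sqrt (1 + t') <= q + a.
  have qa0 : 0 <= q + a by lra.
  by rewrite -[leRHS]ger0_norm// -sqrtr_sqr ler_wsqrtr//; nra.
move=> sq; apply: le_trans (_ : expR (q - 1) * expR a <= _).
  by rewrite -expRD ler_expR; lra.
have a12 : a <= 2^-1 by lra.
apply: le_trans (ler_wpM2l (expR_ge0 _) (expR_le_quad a12)) _.
rewrite [g * _](_ : _ = expR (q - 1) * (g * d / q)); last by field; lra.
rewrite -mulrDr ler_wpM2l ?expR_ge0//.
have -> : g * d / q = a - g ^+ 2 / 2 / q by rewrite /a; field; lra.
have : g ^+ 2 / 2 / q <= g ^+ 2 / 2.
  by rewrite ler_pdivrMr// ler_peMr// divr_ge0// sqr_ge0.
nra.
Qed.

Lemma lyap_drift_aux (l q s f c : R) : 1 <= q -> 0 < l -> 0 < c ->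
  c * s <= f * q -> l - 1 <= 2 * (l * (s / q ^+ 2)) ->
  - (l / q * f) <= - (c / 2) * (l - 1).
Proof.
move=> q1 l0 c0 csf ls; have q0 : 0 < q by lra.
have : c * (l * (s / q ^+ 2)) <= l / q * f.
  rewrite (_ : c * _ = l / q ^+ 2 * (c * s)); last by field; lra.
  rewrite (_ : l / q * f = l / q ^+ 2 * (f * q)); last by field; lra.
  by rewrite ler_wpM2l// divr_ge0 ?sqr_ge0// ltW.
have := ler_wpM2l (ltW c0) ls; lra.
Qed.

Lemma lyap_rec_aux (w' w f g c : R) : 0 < g -> g <= c / 36 -> 0 <= w ->
  w' <= (1 + 9 * g ^+ 2) * (w + 1) + g * f -> f <= - (c / 2) * w ->
  w' - 1 <= (1 - c / 4 * g) * w + 9 * g ^+ 2.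
Proof.
move=> g0 gc w0 h1 h2.
have : g * f <= g * (- (c / 2) * w) by rewrite ler_pM2l.
(* The condition g <= c/36 lets half of the contraction c/2 absorb the multiplicative error. *)
have : 9 * g ^+ 2 * w <= c / 4 * g * w.
  by rewrite ler_wpM2r// expr2 mulrA ler_wpM2r ?(ltW g0)//; lra.
lra.
Qed.

End lyapunov.

(** * Real sequences *)

Section sequences.
Context (R : realType).
Implicit Types (a b w gamma : nat -> R).

Lemma nat_above (x : R) : exists N : nat, x <= N%:R.
Proof. by exists (Num.truncn x).+1; rewrite ltW// truncnS_gt. Qed.

Lemma sqrt_natS_le (n : nat) : (1 <= n)%N ->
  Num.sqrt (n.+1%:R : R) <= 2 * Num.sqrt n%:R.
Proof.
move=> n1; have nR : 1 <= n%:R :> R by rewrite ler1n.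
rewrite -(@ler_pXn2r _ 2)// ?nnegrE ?exprMn ?sqr_sqrtr ?mulr_ge0 ?sqrtr_ge0//.
by rewrite -natr1; lra.
Qed.

(** One-sided o(sqrt n), to be applied to nonnegative sequences. *)
Definition small_sqrt a := forall e : R, 0 < e ->
  exists N, forall n, (N <= n)%N -> a n <= e * Num.sqrt n%:R.

Lemma small_sqrtD a b : small_sqrt a -> small_sqrt b ->
  small_sqrt (fun n => a n + b n).
Proof.
move=> sa sb e e0; have e20 : 0 < e / 2 by rewrite divr_gt0.
have [N1 h1] := sa _ e20; have [N2 h2] := sb _ e20.
exists (maxn N1 N2) => n; rewrite geq_max => /andP[/h1 + /h2]; lra.
Qed.

Lemma small_sqrtZ a (k : R) : 0 <= k -> small_sqrt a ->
  small_sqrt (fun n => k * a n).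
Proof.
move=> k0 sa e e0; have k1 : 0 < k + 1 by lra.
have [N h] := sa _ (divr_gt0 e0 k1).
exists N => n /h /(ler_wpM2l k0) /le_trans; apply.
rewrite mulrA ler_wpM2r ?sqrtr_ge0// mulrCA ler_piMr ?(ltW e0)//.
by rewrite ler_pdivrMr// mul1r lerDl.
Qed.

Lemma small_sqrt_cst (k : R) : small_sqrt (fun=> k).
Proof.
move=> e e0; have [N hN] := nat_above ((k / e) ^+ 2).
exists N => n Nn.
have : Num.sqrt ((k / e) ^+ 2) <= Num.sqrt n%:R.
  by rewrite ler_wsqrtr// (le_trans hN)// ler_nat.
rewrite sqrtr_sqr => /(le_trans (ler_norm _)).
by rewrite ler_pdivrMr// mulrC.
Qed.

(** Increments that are o(1/sqrt n) add up to o(sqrt n), because sqrt(n+1) - sqrt n is at least 1/(3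
    sqrt n). *)
Lemma small_sqrt_sum a b :
  (forall n, (1 <= n)%N -> a n.+1 <= a n + b n) ->
  (forall e : R, 0 < e ->
     exists N, forall n, (N <= n)%N -> Num.sqrt n%:R * b n <= e) ->
  small_sqrt a.
Proof.
move=> ab sb e e0; have e60 : 0 < e / 6 by rewrite divr_gt0.
have [N1 hN1] := sb _ e60.
pose N := maxn 1 N1.
have bound n : (N <= n)%N -> a n <= `|a N| + e / 2 * Num.sqrt n%:R.
  move=> /subnK <-; elim: (n - N)%N => [|k IH].
    by rewrite add0n (le_trans (ler_norm _))// lerDl mulr_ge0 ?sqrtr_ge0// divr_ge0// ltW.
  rewrite addSn; set j := (k + N)%N in IH *.
  have Nj : (N <= j)%N by rewrite leq_addl.
  have j1 : (1 <= j)%N by rewrite (leq_trans _ Nj)// leq_max leqnn.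
  have := hN1 j; rewrite (leq_trans _ Nj) ?leq_max ?leqnn ?orbT// => /(_ isT).
  have := ab j j1.
  set s := Num.sqrt j%:R in IH *; set t := Num.sqrt j.+1%:R.
  have sE : s ^+ 2 = j%:R by rewrite sqr_sqrtr.
  have tE : t ^+ 2 = j%:R + 1 by rewrite sqr_sqrtr// -natr1.
  have jR : 1 <= j%:R :> R by rewrite ler1n.
  have s1 : 1 <= s by rewrite -[leLHS]sqrtr1 ler_wsqrtr.
  have t0 : 0 <= t by exact: sqrtr_ge0.
  have t2s : t <= 2 * s.
    by rewrite -(@ler_pXn2r _ 2)// ?nnegrE ?exprMn ?tE ?sE; lra.
  move=> h1 h2.
  have st : 1 <= 3 * s * (t - s).
    have : (t - s) * (t + s) = 1 by rewrite -subr_sqr tE sE; ring.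
    have : 0 <= t - s by rewrite subr_ge0 ler_wsqrtr// ler_nat.
    nra.
  suff : b j <= e / 2 * (t - s) by lra.
  have s0 : 0 < s by lra.
  rewrite -(ler_pM2l s0) (le_trans h2)//.
  have := ler_wpM2l (ltW e60) st; lra.
have e20 : 0 < e / 2 by rewrite divr_gt0.
have [N2 hN2] := small_sqrt_cst `|a N| e20.
exists (maxn N N2) => n; rewrite geq_max => /andP[/bound + /hN2]; lra.
Qed.

(** Induction on w n <= B gamma n. Once n gamma n >= 2/c, passing from gamma n to gamma n.+1 costs
    at most half of the contraction; the other half pays for K gamma n^2 as soon as B >= 2 K / c. *)
Lemma stochastic_approximation_rate gamma w (c K g0 : R) :
  0 < c -> 0 < g0 -> 0 < K ->
  (forall n, (1 <= n)%N -> 0 < gamma n) ->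
  (forall n, (1 <= n)%N -> gamma n - gamma n.+1 <= gamma n / n%:R) ->
  (forall e : R, 0 < e ->
     exists N, forall n, (N <= n)%N -> gamma n <= e) ->
  (forall k : R, exists N, forall n, (N <= n)%N -> k <= n%:R * gamma n) ->
  (forall n, (1 <= n)%N -> gamma n <= g0 ->
     w n.+1 <= (1 - c * gamma n) * w n + K * gamma n ^+ 2) ->
  exists2 B : R, 0 < B & exists N, forall n, (N <= n)%N -> w n <= B * gamma n.
Proof.
move=> c0 g00 K0 gpos gdecr gsmall gslow rec.
have [N1 hN1] := gsmall _ g00.
have c10 : 0 < c^-1 by rewrite invr_gt0.
have [N2 hN2] := gsmall _ c10.
have [N3 hN3] := gslow (2 / c).
pose N := maxn (maxn 1 N1) (maxn N2 N3).
have NN n : (N <= n)%N -> [/\ (1 <= n)%N, (N1 <= n)%N, (N2 <= n)%N & (N3 <= n)%N].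
  by rewrite !geq_max => /andP[/andP[-> ->] /andP[-> ->]].
have gN : 0 < gamma N by apply: gpos; have [] := NN N (leqnn N).
(* The first term starts the induction at N, the second makes B large enough for the inductive
   step. *)
exists (`|w N| / gamma N + 2 * K / c).
  by rewrite ltr_wpDl ?divr_ge0 ?divr_gt0 ?mulr_gt0// ltW.
exists N => n /subnK <-; elim: (n - N)%N => [|k IH].
  rewrite add0n mulrDl divfK ?gt_eqF// (le_trans (ler_norm _))// lerDl.
  by rewrite !mulr_ge0 ?invr_ge0 ?ltW.
move: IH; set B := `|w N| / _ + _; rewrite addSn; set j := (k + N)%N => IH.
have [j1 jN1 jN2 jN3] := NN j (leq_addl _ _).
have gj := gpos j j1; have := rec j j1 (hN1 j jN1); have := gdecr j j1.
have cg : c * gamma j <= 1.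
  by have := hN2 j jN2; rewrite -(ler_pM2l c0) mulfV ?gt_eqF.
have BK : 2 * K <= B * c.
  rewrite /B (mulrDl (`|w N| / _)) divfK ?gt_eqF//.
  by rewrite lerDr mulr_ge0 ?divr_ge0// ltW.
have jR : 0 < j%:R :> R by rewrite ltr0n.
have : gamma j / j%:R <= c / 2 * gamma j ^+ 2.
  rewrite ler_pdivrMr//; have := hN3 j jN3.
  rewrite ler_pdivrMr// => h.
  have := ler_wpM2l (ltW gj) h; lra.
have B0 : 0 <= B by rewrite /B addr_ge0 ?divr_ge0 ?mulr_ge0// ltW.
move=> g1 g2 h.
have : (1 - c * gamma j) * w j <= (1 - c * gamma j) * (B * gamma j).
  by rewrite ler_wpM2l// subr_ge0.
have : B * (gamma j - gamma j.+1) <= B * (c / 2 * gamma j ^+ 2).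
  by rewrite ler_wpM2l// (le_trans g2).
have : 2 * K * gamma j ^+ 2 <= B * c * gamma j ^+ 2 by rewrite ler_wpM2r ?sqr_ge0.
lra.
Qed.

(* [t^2 <= k |t| + t^4 / k^2] compares the first moment with the second and
   fourth ones. *)
Lemma sqr_le_interpolation (t k : R) : 0 < k ->
  t ^+ 2 <= k * `|t| + t ^+ 4 / k ^+ 2.
Proof.
move=> k0; have k20 : 0 < k ^+ 2 by rewrite exprn_gt0.
have t4 : 0 <= t ^+ 4 / k ^+ 2 by rewrite divr_ge0 ?(ltW k20)// exprn_even_ge0.
have [tk|tk] := leP `|t| k.
  apply: le_trans (_ : k * `|t| <= _); last by rewrite lerDl.
  by rewrite -[leLHS]real_normK ?num_real// expr2 ler_wpM2r.
apply: le_trans (_ : t ^+ 4 / k ^+ 2 <= _); last by rewrite lerDr mulr_ge0// ltW.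
rewrite ler_pdivlMr// (_ : t ^+ 4 = t ^+ 2 * t ^+ 2); last by ring.
rewrite ler_wpM2l ?sqr_ge0// -[leRHS]real_normK ?num_real//.
by rewrite lerXn2r ?nnegrE// ltW.
Qed.

(** The cubic cross term x^3 y stays exact because its expectation will vanish; 4 x y^3 is split by
    y^2 (x - y)^2 >= 0. *)
Lemma pow4_add_le (x y l : R) : `|y| <= l ->
  (x + y) ^+ 4 <=
  x ^+ 4 + 4 * (x ^+ 3 * y) + (8 * l ^+ 2 * x ^+ 2 + 3 * l ^+ 4).
Proof.
move=> yl'; have l0 : 0 <= l by rewrite (le_trans _ yl').
have yl : y ^+ 2 <= l ^+ 2.
  by rewrite -[leLHS]real_normK ?num_real// lerXn2r ?nnegrE.
have y4 : y ^+ 4 <= l ^+ 4.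
  rewrite (_ : y ^+ 4 = y ^+ 2 * y ^+ 2); last by ring.
  rewrite (_ : l ^+ 4 = l ^+ 2 * l ^+ 2); last by ring.
  by rewrite ler_pM ?sqr_ge0.
have xy : x ^+ 2 * y ^+ 2 <= x ^+ 2 * l ^+ 2 by rewrite ler_wpM2l ?sqr_ge0.
have := sqr_ge0 (y * (x - y)); nra.
Qed.

Lemma pow4_rec_le (f g l x : R) : 0 <= x ->
  f <= 8 * l ^+ 4 * x ^+ 2 -> g <= l ^+ 2 * x ->
  f + (8 * l ^+ 2 * g + 3 * l ^+ 4) <= 8 * l ^+ 4 * (x + 1) ^+ 2.
Proof.
move=> x0 fl gl; have l4 : 0 <= l ^+ 4 by rewrite exprn_even_ge0.
have := ler_wpM2l (sqr_ge0 l) gl; have := mulr_ge0 l4 x0; nra.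
Qed.

End sequences.

(** * The stochastic gradient process *)

Section process.
Context (R : realType) (H : completeNormedModType R) (ip : H -> H -> R).
Hypotheses (ipP : inner_product ip) (sepH : separable_space H).
Context d (T : measurableType d) (P : probability T R).
Variables (X : {RV P >-> borelType H}) (m : H).
Hypothesis nondegX : forall h : H, exists h' : H,
  ip h h' = 0 /\ (0 < 'V_P[fun w => ip (X w : H) h'])%E.
Variable C : R.
Hypothesis C_gt0 : 0 < C.
Hypothesis invX : forall h : H,
    (\int[P]_w (`|(X w : H) - h|%R%:E)^-1 <= C%:E)%E /\
    (\int[P]_w ((`|(X w : H) - h| ^+ 2)%R%:E)^-1 <= C%:E)%E.
Hypothesis medX : geometric_median X m.
Variable Xs : nat -> {RV P >-> borelType H}.
Hypothesis indX : mutually_independent [set n | (1 <= n)%N] Xs.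
Hypothesis lawX : forall n, (1 <= n)%N -> same_law (Xs n) X.
Variables (gamma : nat -> R) (Z : nat -> T -> H).
(** The four properties through which the step sizes enter. For powers, [gamma_fast] expresses alpha
    > 1/2, [gamma_slow] expresses alpha < 1, and [gamma_decr] says that the relative decrease is at
    most 1/n. *)
Hypothesis gamma_gt0 : forall n, (1 <= n)%N -> 0 < gamma n.
Hypothesis gamma_decr : forall n, (1 <= n)%N ->
  0 <= gamma n - gamma n.+1 <= gamma n / n%:R.
Hypothesis gamma_fast : forall e : R, 0 < e ->
  exists N, forall n, (N <= n)%N -> Num.sqrt n%:R * gamma n <= e.
Hypothesis gamma_slow : forall k : R,
  exists N, forall n, (N <= n)%N -> k <= n%:R * gamma n.
Hypothesis Z_step : stochastic_gradient gamma Xs Z.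
Hypothesis Z1_past : measurable_fun setT (Z 1%N : past Xs 1 -> borelType H).

Local Notation phi := (phi ip X).
Local Notation psi := (psi ip X).
Local Notation hess := (hess ip X m).
Local Notation past_fun n f := (measurable_fun setT (f : past Xs n -> R)).
Local Notation past_borel n f :=
  (measurable_fun setT (f : past Xs n -> borelType H)).

Let mX : measurable_fun setT (X : T -> borelType H).
Proof. exact: measurable_funPT. Qed.

Lemma Z_stepE n w : (1 <= n)%N ->
  Z n.+1 w = Z n w + gamma n *: dir ((Xs n.+1 w : H) - Z n w).
Proof. by move=> n1; rewrite Z_step// dir.unlock. Qed.

Lemma Z_past n : (1 <= n)%N -> past_borel n (Z n).
Proof.
case: n => // n _; elim: n => [|n IH]; first exact: Z1_past.
rewrite (_ : Z n.+2 = fun w =>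
  Z n.+1 w + gamma n.+1 *: dir ((Xs n.+2 w : H) - Z n.+1 w)); last first.
  by apply/funext => w; rewrite Z_stepE.
have mZ : past_borel n.+2 (Z n.+1) by exact: past_measurable_funS.
apply: (borelD sepH mZ); apply: (borelZ ipP sepH) => //.
apply: (borel_dir ipP sepH); apply: (borelB sepH) => //.
exact: past_measurable_last.
Qed.

Lemma Z_measurable n : (1 <= n)%N ->
  measurable_fun setT (Z n : T -> borelType H).
Proof. by move=> n1; apply: past_measurable_fun (Z_past n1). Qed.

Variable M : R.
Hypothesis Z1_bounded : forall w, `|Z 1%N w| <= M.

(** A step moves by at most gamma n. The bound depends on n and serves integrability, not the
    rate. *)
Lemma Z_bounded n : (1 <= n)%N -> exists K : R, forall w, `|Z n w| <= K.
Proof.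
case: n => // n _; elim: n => [|n [K ZK]]; first by exists M.
exists (K + gamma n.+1) => w; rewrite Z_stepE//.
rewrite (le_trans (ler_normD _ _))// lerD// normrZ gtr0_norm ?gamma_gt0//.
by rewrite ler_piMr ?norm_dir_le1// ltW// gamma_gt0.
Qed.

Lemma Zm_bounded n : (1 <= n)%N -> exists K : R, forall w, `|Z n w - m| <= K.
Proof.
move=> /Z_bounded[K ZK]; exists (K + `|m|) => w.
by rewrite (le_trans (ler_normB _ _))// lerD.
Qed.

Let past_dir n : (1 <= n)%N -> measurable_fun setT
  (fun y : past Xs n * borelType H => dir ((y.2 : H) - Z n y.1) : borelType H).
Proof.
move=> n1; apply: (borel_dir ipP sepH); apply: (borelB sepH).
  exact: measurable_snd.
exact: (measurableT_comp (Z_past n1) measurable_fst).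
Qed.

(** In substance, the conditional expectation of a step given the past, tested against
    past-measurable A and V: V = Z_n - m yields the Lyapunov drift, a constant V the martingale
    property. *)
Lemma freeze_dir n (A : T -> R) (V : T -> H) (KA KV : R) : (1 <= n)%N ->
  past_fun n A -> past_borel n V ->
  (forall w, `|A w| <= KA) -> (forall w, `|V w| <= KV) ->
  Ex P (fun w => A w * ip (dir ((Xs n.+1 w : H) - Z n w)) (V w)) =
  Ex P (fun w => A w * phi (V w) (Z n w)).
Proof.
move=> n1 mA mV AK VK.
pose f (y : past Xs n * borelType H) :=
  A y.1 * ip (dir ((y.2 : H) - Z n y.1)) (V y.1).
have mf : measurable_fun setT f.
  apply: measurable_funM; first exact: (measurableT_comp mA measurable_fst).
  apply: (borel_ip ipP sepH (past_dir n1)).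
  exact: (measurableT_comp mV measurable_fst).
have fK y : `|f y| <= KA * KV.
  rewrite normrM ler_pM//.
  by rewrite (le_trans (ip_dir_le ipP _ _)).
rewrite [LHS](past_freezing indX lawX mf fK).
apply: eq_Ex => w; rewrite /f /= ExZ//.
exact: (intg_ip_dir ipP sepH).
Qed.

Lemma past_phi n (V : T -> H) (KV : R) : (1 <= n)%N ->
  past_borel n V -> (forall w, `|V w| <= KV) ->
  past_fun n (fun w => phi (V w) (Z n w)).
Proof.
move=> n1 mV VK.
pose f (y : past Xs n * borelType H) :=
  ip (dir ((y.2 : H) - Z n y.1)) (V y.1).
have mf : measurable_fun setT f.
  apply: (borel_ip ipP sepH (past_dir n1)).
  exact: (measurableT_comp mV measurable_fst).
have fK y : `|f y| <= KV by rewrite (le_trans (ip_dir_le ipP _ _)).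
exact: (past_freezing_measurable X mf fK).
Qed.

Lemma freeze_dir_sqr n e : (1 <= n)%N ->
  Ex P (fun w => ip (dir ((Xs n.+1 w : H) - Z n w)) e ^+ 2) =
  Ex P (fun w => psi e (Z n w)).
Proof.
move=> n1.
pose f (y : past Xs n * borelType H) := ip (dir ((y.2 : H) - Z n y.1)) e ^+ 2.
have mf : measurable_fun setT f.
  apply: measurable_funX; apply: (borel_ip ipP sepH (past_dir n1)).
  exact: borel_cst.
have fK y : `|f y| <= `|e| ^+ 2.
  by rewrite ger0_norm ?sqr_ge0// (ip_dir_sqr_le ipP).
by rewrite [LHS](past_freezing indX lawX mf fK).
Qed.

Lemma past_psi n e : (1 <= n)%N -> past_fun n (fun w => psi e (Z n w)).
Proof.
move=> n1.
pose f (y : past Xs n * borelType H) := ip (dir ((y.2 : H) - Z n y.1)) e ^+ 2.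
have mf : measurable_fun setT f.
  apply: measurable_funX; apply: (borel_ip ipP sepH (past_dir n1)).
  exact: borel_cst.
have fK y : `|f y| <= `|e| ^+ 2.
  by rewrite ger0_norm ?sqr_ge0// (ip_dir_sqr_le ipP).
exact: (past_freezing_measurable X mf fK).
Qed.

(** * Mean-square rate of the iterates *)

Let lyapZ n w := lyap (`|Z n w - m| ^+ 2).

Let past_sqrdist n : (1 <= n)%N -> past_fun n (fun w => `|Z n w - m| ^+ 2).
Proof.
by move=> n1; apply: measurable_funX; exact: (borel_dist _ (Z_past n1)).
Qed.

Let past_lyap n : (1 <= n)%N -> past_fun n (lyapZ n).
Proof.
move=> n1; apply: (measurableT_comp (@measurable_expR R)).
apply: measurable_funB => //; apply: measurable_sqrtr_ge0.
  by move=> w; rewrite addr_ge0 ?sqr_ge0.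
by apply: measurable_funD => //; exact: past_sqrdist.
Qed.

Let lyapZ_bounded n : (1 <= n)%N -> exists K, forall w, `|lyapZ n w| <= K.
Proof.
move=> /Zm_bounded[K ZK]; exists (lyap (K ^+ 2)) => w.
rewrite ger0_norm ?expR_ge0// /lyapZ /lyap ler_expR lerD2r ler_wsqrtr// lerD2l.
have K0 : 0 <= K by rewrite (le_trans _ (ZK w)).
by rewrite lerXn2r ?nnegrE.
Qed.

Let intg_lyap n : (1 <= n)%N -> intg P (lyapZ n).
Proof.
move=> n1; have [K LK] := lyapZ_bounded n1.
apply: (@bounded_intg _ _ _ _ _ K) => //.
exact: past_measurable_fun (past_lyap n1).
Qed.

Lemma lyapunov_recursion : exists2 c : R, 0 < c &
  exists2 g0 : R, 0 < g0 & forall n, (1 <= n)%N -> gamma n <= g0 ->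
  Ex P (fun w => lyapZ n.+1 w - 1) <=
    (1 - c * gamma n) * Ex P (fun w => lyapZ n w - 1) + 9 * gamma n ^+ 2.
Proof.
have [c c0 drift] := median_drift ipP sepH nondegX C_gt0 invX medX.
exists (c / 4); first by rewrite divr_gt0.
(* The bound 1/4 is required by [lyap_step], c/36 by [lyap_rec_aux]. *)
exists (Num.min 4^-1 (c / 36)); first by rewrite lt_min invr_gt0 ltr0n divr_gt0.
move=> n n1; rewrite le_min => /andP[g4 gc]; have g0 := gamma_gt0 n1.
set g := gamma n in g4 gc g0 *.
pose r2 w := `|Z n w - m| ^+ 2.
(* Twice the derivative of [lyap] at r2, the coefficient of the first-order term in [lyap_step]. It
   depends only on the past, so the step next to it can be averaged. *)
pose A w := lyapZ n w / Num.sqrt (1 + r2 w).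
have r20 w : 0 <= r2 w by exact: sqr_ge0.
have [K LK] := lyapZ_bounded n1; have [Kz ZK] := Zm_bounded n1.
have AL w : 0 <= A w <= lyapZ n w.
  have q1 := sqrt1D_ge1 (r20 w).
  rewrite divr_ge0 ?expR_ge0 ?sqrtr_ge0//= ler_pdivrMr; last lra.
  by rewrite ler_peMr// expR_ge0.
have AK w : `|A w| <= K.
  have /andP[a0 aL] := AL w; rewrite ger0_norm// (le_trans aL)//.
  by rewrite (le_trans (ler_norm _)).
have mA : past_fun n A.
  apply: measurable_funM; first exact: past_lyap.
  apply: measurable_invr_ge0 => [w|]; first exact: sqrtr_ge0.
  apply: measurable_sqrtr_ge0 => [w|]; first by rewrite addr_ge0.
  by apply: measurable_funD => //; exact: past_sqrdist.
have mV : past_borel n (fun w => Z n w - m).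
  by apply: (borelB sepH); [exact: Z_past|exact: borel_cst].
have E := freeze_dir n1 mA mV AK ZK.
have IA1 : intg P (fun w => A w * ip (dir ((Xs n.+1 w : H) - Z n w)) (Z n w - m)).
  apply: (@bounded_intg _ _ _ _ _ (K * Kz)) => [|w].
    apply: measurable_funM; first exact: past_measurable_fun mA.
    apply: (borel_ip ipP sepH); last exact: past_measurable_fun mV.
    apply: (borel_dir ipP sepH); apply: (borelB sepH); first exact: measurable_funPT.
    exact: Z_measurable.
  by rewrite normrM ler_pM// (le_trans (ip_dir_le ipP _ _)).
have IA2 : intg P (fun w => A w * phi (Z n w - m) (Z n w)).
  apply: (@bounded_intg _ _ _ _ _ (K * Kz)) => [|w].
    apply: past_measurable_fun (measurable_funM mA _).
    exact: past_phi ZK.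
  by rewrite normrM ler_pM// (le_trans (phi_le ipP sepH _ _ _)).
have IL := intg_lyap n1; have IL' := intg_lyap (leqW n1).
have I1 : intg P (fun w => lyapZ n w - 1) by apply: intgB => //; exact: intg_cst.
have S1 : Ex P (lyapZ n.+1) <= (1 + 9 * g ^+ 2) * Ex P (lyapZ n) +
    g * Ex P (fun w => A w * ip (dir ((Xs n.+1 w : H) - Z n w)) (Z n w - m)).
  rewrite -!ExZ// -ExD; [|exact: intgZ..].
  apply: le_Ex => // [|w]; first by apply: intgD; exact: intgZ.
  rewrite [X in _ <= X + _]mulrC; apply: lyap_step; rewrite ?sqr_ge0//.
  - by rewrite (ltW g0).
  - by rewrite sqrtr_sqr normr_id (ip_dir_le ipP).
  - rewrite Z_stepE// addrAC (normDsq ipP) (ipZr ipP) normrZ exprMn (ipC ipP).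
    rewrite real_normK ?num_real// -/g mulrA lerD2l.
    by apply: ler_piMr; rewrite ?sqr_ge0// expr_le1 ?norm_dir_le1.
have S2 : Ex P (fun w => A w * phi (Z n w - m) (Z n w)) <=
    - (c / 2) * Ex P (fun w => lyapZ n w - 1).
  rewrite -ExZ//; apply: le_Ex => // [|w]; first exact: intgZ.
  have zE : m + (Z n w - m) = Z n w by rewrite addrC subrK.
  have := drift (Z n w - m); rewrite zE -/(r2 w) => D.
  have q1 := sqrt1D_ge1 (r20 w); have L0 : 0 < lyapZ n w by exact: expR_gt0.
  have := lyap_contraction (r20 w); rewrite -/(lyapZ n w).
  rewrite /A; set q := Num.sqrt _ in q1 D *.
  have qE : q ^+ 2 = 1 + r2 w by rewrite sqr_sqrtr// addr_ge0.
  rewrite -qE => lc.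
  rewrite -[leLHS]opprK -mulrN; exact: lyap_drift_aux lc.
rewrite E in S1.
have W0 : 0 <= Ex P (fun w => lyapZ n w - 1).
  by apply: Ex_ge0 => w; rewrite subr_ge0 lyap_ge1.
rewrite ExB ?Ex_cst//; last exact: intg_cst.
have WE : Ex P (lyapZ n) = Ex P (fun w => lyapZ n w - 1) + 1.
  by rewrite ExB ?Ex_cst ?subrK//; exact: intg_cst.
by apply: (lyap_rec_aux g0 gc W0 _ S2); rewrite -WE.
Qed.

Lemma gamma_small (e : R) : 0 < e ->
  exists N, forall n, (N <= n)%N -> gamma n <= e.
Proof.
move=> e0; have [N hN] := gamma_fast e0.
exists (maxn 1 N) => n; rewrite geq_max => /andP[n1 /hN]; apply: le_trans.
rewrite ler_peMl ?(ltW (gamma_gt0 n1))// -[leLHS]sqrtr1 ler_wsqrtr//.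
by rewrite ler1n.
Qed.

Let r n w := `|Z n w - m|.

Lemma measurable_r n : (1 <= n)%N -> measurable_fun setT (r n).
Proof. by move=> n1; exact: (borel_dist _ (Z_measurable n1)). Qed.

Lemma intg_r n : (1 <= n)%N -> intg P (r n).
Proof.
move=> n1; have [K ZK] := Zm_bounded n1.
apply: (@bounded_intg _ _ _ _ _ K); first exact: measurable_r.
by move=> w; rewrite normr_id.
Qed.

Lemma intg_r2 n : (1 <= n)%N -> intg P (fun w => r n w ^+ 2).
Proof.
move=> n1; have [K ZK] := Zm_bounded n1.
apply: (@bounded_intg _ _ _ _ _ (K ^+ 2)).
  exact/measurable_funX/measurable_r.
move=> w; rewrite normrX normr_id lerXn2r ?nnegrE//.
by rewrite (le_trans _ (ZK w)).
Qed.

Lemma Z_rate : exists2 B : R, 0 < B &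
  exists N, forall n, (N <= n)%N -> Ex P (fun w => r n w ^+ 2) <= B * gamma n.
Proof.
have [c c0 [g0 g00 rec]] := lyapunov_recursion.
have decr n (n1 : (1 <= n)%N) : gamma n - gamma n.+1 <= gamma n / n%:R.
  by have /andP[] := gamma_decr n1.
have K0 : 0 < 9 :> R by [].
have [B B0 [N hN]] := stochastic_approximation_rate c0 g00 K0 gamma_gt0 decr
  gamma_small gamma_slow rec.
exists (4 * B); first by rewrite mulr_gt0.
exists (maxn 1 N) => n; rewrite geq_max => /andP[n1 /hN h].
have I1 : intg P (fun w => lyapZ n w - 1).
  by apply: intgB; [exact: intg_lyap|exact: intg_cst].
apply: le_trans (_ : Ex P (fun w => 4 * (lyapZ n w - 1)) <= _).
  apply: le_Ex; [exact: intg_r2|exact: intgZ|move=> w].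
  exact: lyap_ge (sqr_ge0 _).
by rewrite ExZ// -mulrA ler_wpM2l.
Qed.

(** (E r_n)^2 <= B gamma n, which is at most e^2 n gamma n^2 once n gamma n >= B/e^2. In this form,
    division by gamma n yields o(sqrt n), as the Abel remainder demands. *)
Lemma Z_rate1 (e : R) : 0 < e -> exists N, forall n, (N <= n)%N ->
  Ex P (r n) <= e * (Num.sqrt n%:R * gamma n).
Proof.
move=> e0; have [B B0 [N1 h1]] := Z_rate.
have [N2 h2] := gamma_slow (B / e ^+ 2).
exists (maxn 1 (maxn N1 N2)) => n.
rewrite !geq_max => /and3P[n1 /h1 hr /h2 hg].
have g0 := gamma_gt0 n1.
rewrite -(@ler_pXn2r _ 2)// ?nnegrE; last 2 first.
- by apply: Ex_ge0 => w; rewrite /r.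
- by rewrite !mulr_ge0 ?sqrtr_ge0// ltW.
rewrite (le_trans (sqr_Ex_le (intg_r n1) (intg_r2 n1)))// (le_trans hr)//.
rewrite !exprMn sqr_sqrtr//; move: hg; rewrite ler_pdivrMr ?exprn_gt0// => hg.
have := ler_wpM2r (ltW g0) hg; lra.
Qed.

(** * Moments of the martingale in a fixed direction *)

Section martingale.
Variable e : H.

Definition noise n w : R := ip (dir ((Xs n.+1 w : H) - Z n w)) e - phi e (Z n w).
Definition mart n w : R := \sum_(1 <= k < n.+1) noise k w.

Local Notation L := (2 * `|e|).

Lemma noise_le n w : `|noise n w| <= L.
Proof.
rewrite (le_trans (ler_normB _ _))// mulr_natl mulr2n lerD//.
  exact: (ip_dir_le ipP).
exact: (phi_le ipP sepH).
Qed.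

Lemma past_phi_cst n : (1 <= n)%N -> past_fun n (fun w => phi e (Z n w)).
Proof.
move=> n1; exact: (@past_phi n (fun=> e) `|e| n1 (borel_cst e) (fun=> lexx _)).
Qed.

Lemma past_noise n : (1 <= n)%N -> past_fun n.+1 (noise n).
Proof.
move=> n1; apply: measurable_funB.
  apply: (borel_ip ipP sepH); last exact: borel_cst.
  apply: (borel_dir ipP sepH); apply: (borelB sepH); first exact: past_measurable_last.
  exact: past_measurable_funS (Z_past n1).
exact: past_measurable_funS (past_phi_cst n1).
Qed.

Lemma measurable_noise n : (1 <= n)%N -> measurable_fun setT (noise n).
Proof. by move=> n1; exact: past_measurable_fun (past_noise n1). Qed.

Lemma martS n w : mart n.+1 w = mart n w + noise n.+1 w.
Proof. by rewrite /mart big_nat_recr. Qed.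

Lemma past_mart n : past_fun n.+1 (mart n).
Proof.
elim: n => [|n IH].
  by rewrite (_ : mart 0 = cst 0)//; apply/funext => w; rewrite /mart big_geq.
rewrite (_ : mart n.+1 = fun w => mart n w + noise n.+1 w); last first.
  by apply/funext => w; exact: martS.
apply: measurable_funD; last exact: past_noise.
exact: past_measurable_funS IH.
Qed.

Lemma measurable_mart n : measurable_fun setT (mart n).
Proof. exact: past_measurable_fun (@past_mart n). Qed.

Lemma mart_le n w : `|mart n w| <= L * n%:R.
Proof.
elim: n => [|n IH]; first by rewrite /mart big_geq// normr0 mulr0.
rewrite martS (le_trans (ler_normD _ _))// -[n.+1%:R]natr1 mulrDr mulr1 lerD//.
exact: noise_le.
Qed.

Lemma noise_orthogonal n (A : T -> R) (KA : R) : (1 <= n)%N ->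
  past_fun n A -> (forall w, `|A w| <= KA) ->
  Ex P (fun w => A w * noise n w) = 0.
Proof.
move=> n1 mA AK.
have E := freeze_dir n1 mA (borel_cst e) AK (fun=> lexx _).
have mAT : measurable_fun setT A by exact: past_measurable_fun mA.
have I1 : intg P (fun w => A w * ip (dir ((Xs n.+1 w : H) - Z n w)) e).
  apply: (@bounded_intg _ _ _ _ _ (KA * `|e|)) => [|w].
    apply: measurable_funM => //; apply: (borel_ip ipP sepH); last exact: borel_cst.
    apply: (borel_dir ipP sepH); apply: (borelB sepH); first exact: measurable_funPT.
    exact: Z_measurable.
  by rewrite normrM ler_pM// (ip_dir_le ipP).
have I2 : intg P (fun w => A w * phi e (Z n w)).
  apply: (@bounded_intg _ _ _ _ _ (KA * `|e|)) => [|w].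
    by apply: measurable_funM => //; exact: past_measurable_fun (past_phi_cst n1).
  by rewrite normrM ler_pM// (phi_le ipP sepH).
under eq_Ex do rewrite mulrBr.
by rewrite ExB// E subrr.
Qed.

Lemma intg_noise_mul n (A : T -> R) (KA : R) : (1 <= n)%N -> measurable_fun setT A ->
  (forall w, `|A w| <= KA) -> intg P (fun w => A w * noise n w).
Proof.
move=> n1 mA AK; apply: (@bounded_intg _ _ _ _ _ (KA * L)) => [|w].
  by apply: measurable_funM => //; exact: measurable_noise.
by rewrite normrM ler_pM// noise_le.
Qed.

(** The conditional variance of the noise is psi e (Z_n) - phi e (Z_n)^2. Replacing Z_n by m costs 4
    C in the first term and 2 C in the second, since [phi e] vanishes at m and is bounded by |e|. *)
Lemma noise_variance n : (1 <= n)%N ->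
  psi e m - 6 * C * `|e| ^+ 2 * Ex P (r n) <= Ex P (fun w => noise n w ^+ 2).
Proof.
move=> n1.
pose u w := ip (dir ((Xs n.+1 w : H) - Z n w)) e.
pose f w := phi e (Z n w).
have mu : measurable_fun setT u.
  apply: (borel_ip ipP sepH); last exact: borel_cst.
  apply: (borel_dir ipP sepH); apply: (borelB sepH); first exact: measurable_funPT.
  exact: Z_measurable.
have mf : measurable_fun setT f by exact: past_measurable_fun (past_phi_cst n1).
have uE w : `|u w| <= `|e| by exact: (ip_dir_le ipP).
have fE w : `|f w| <= `|e| by exact: (phi_le ipP sepH).
have bdd2 (g h : T -> R) : measurable_fun setT g -> measurable_fun setT h ->
    (forall w, `|g w| <= `|e|) -> (forall w, `|h w| <= `|e|) ->
    intg P (fun w => g w * h w).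
  move=> mg mh gE hE; apply: (@bounded_intg _ _ _ _ _ (`|e| * `|e|)).
    exact: measurable_funM.
  by move=> w; rewrite normrM ler_pM.
have Iuu := bdd2 _ _ mu mu uE uE; have Ifu := bdd2 _ _ mf mu fE uE.
have Iff := bdd2 _ _ mf mf fE fE.
have Ipsi : intg P (fun w => psi e (Z n w)).
  apply: (@bounded_intg _ _ _ _ _ (`|e| ^+ 2)).
    exact: past_measurable_fun (past_psi e n1).
  by move=> w; exact: (psi_le ipP sepH).
have Efu : Ex P (fun w => f w * u w) = Ex P (fun w => f w * f w).
  exact: (freeze_dir n1 (past_phi_cst n1) (borel_cst e) fE (fun=> lexx _)).
have -> : Ex P (fun w => noise n w ^+ 2) =
    Ex P (fun w => psi e (Z n w)) - Ex P (fun w => f w * f w).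
  rewrite -(freeze_dir_sqr e n1).
  transitivity (Ex P (fun w => u w * u w - 2 * (f w * u w) + f w * f w)).
    by apply: eq_Ex => w; rewrite /noise -/(u w) -/(f w); ring.
  have I2 := intgZ 2 Ifu.
  rewrite ExD ?ExB ?ExZ//; last exact: intgB.
  rewrite Efu; under [in RHS]eq_Ex do rewrite expr2.
  by rewrite -/u; ring.
rewrite -ExB// -ExZ; last exact: intg_r.
rewrite -[X in X - _](Ex_cst P) -ExB; [|exact: intg_cst|exact/intgZ/intg_r].
apply: le_Ex => [||w]; [|exact: intgB|].
  by apply: intgB; [exact: intg_cst|exact/intgZ/intg_r].
have h1 := psi_lipschitz ipP sepH invX e (Z n w) m.
have h2 : f w * f w <= 2 * C * r n w * `|e| * `|e|.
  rewrite (le_trans (ler_norm _))// normrM ler_pM//.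
  have := phi_lipschitz ipP sepH invX e (Z n w) m.
  by rewrite (phi_median ipP sepH C_gt0 invX medX) subr0.
move: h1; rewrite ler_norml => /andP[h1 _]; move: h1 h2; rewrite -/(r n w).
set a := psi e _; set b := psi e _; set x := f w * _; set y := r n w; lra.
Qed.

Lemma intg_mart n k : intg P (fun w => mart n w ^+ k).
Proof.
apply: (@bounded_intg _ _ _ _ _ ((L * n%:R) ^+ k)).
  exact/measurable_funX/measurable_mart.
by move=> w; rewrite normrX lerXn2r ?nnegrE ?mulr_ge0// mart_le.
Qed.

Lemma intg_noise_sqr n : (1 <= n)%N -> intg P (fun w => noise n w ^+ 2).
Proof.
move=> n1; apply: (@bounded_intg _ _ _ _ _ (L ^+ 2)).
  exact/measurable_funX/measurable_noise.
by move=> w; rewrite normrX lerXn2r ?nnegrE ?mulr_ge0// noise_le.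
Qed.

Lemma mart_orthogonal n k : Ex P (fun w => mart n w ^+ k * noise n.+1 w) = 0.
Proof.
apply: (@noise_orthogonal _ _ ((L * n%:R) ^+ k)) => // [|w].
  by apply: measurable_funX; exact: past_mart.
by rewrite normrX lerXn2r ?nnegrE ?mulr_ge0// mart_le.
Qed.

Lemma intg_mart_noise n k : intg P (fun w => mart n w ^+ k * noise n.+1 w).
Proof.
apply: (@intg_noise_mul _ _ ((L * n%:R) ^+ k)) => // [|w].
  exact/measurable_funX/measurable_mart.
by rewrite normrX lerXn2r ?nnegrE ?mulr_ge0// mart_le.
Qed.

Lemma mart_sqrS n : Ex P (fun w => mart n.+1 w ^+ 2) =
  Ex P (fun w => mart n w ^+ 2) + Ex P (fun w => noise n.+1 w ^+ 2).
Proof.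
transitivity (Ex P (fun w => mart n w ^+ 2 + 2 * (mart n w ^+ 1 * noise n.+1 w)
   + noise n.+1 w ^+ 2)).
  by apply: eq_Ex => w; rewrite martS; ring.
have I1 := intgZ 2 (intg_mart_noise n 1).
rewrite ExD; [|exact: (intgD (intg_mart n 2) I1)|exact: intg_noise_sqr].
rewrite ExD//; last exact: intg_mart.
by rewrite ExZ ?mart_orthogonal ?mulr0 ?addr0//; exact: intg_mart_noise.
Qed.

Lemma mart_sqr_le n : Ex P (fun w => mart n w ^+ 2) <= L ^+ 2 * n%:R.
Proof.
elim: n => [|n IH].
  rewrite mulr0 -[leRHS](Ex_cst P) le_Ex//; [exact: intg_mart|exact: intg_cst|].
  by move=> w; rewrite /mart big_geq// expr0n.
rewrite mart_sqrS -[n.+1%:R]natr1 mulrDr mulr1 lerD//.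
rewrite -[leRHS](Ex_cst P) le_Ex//; [exact: intg_noise_sqr|exact: intg_cst|].
move=> w; rewrite -[leLHS]ger0_norm ?sqr_ge0// normrX lerXn2r ?nnegrE ?mulr_ge0//.
exact: noise_le.
Qed.

Lemma mart_pow4_le n : Ex P (fun w => mart n w ^+ 4) <= 8 * L ^+ 4 * n%:R ^+ 2.
Proof.
elim: n => [|n IH].
  rewrite expr0n mulr0 -[leRHS](Ex_cst P) le_Ex//; [exact: intg_mart|exact: intg_cst|].
  by move=> w; rewrite /mart big_geq// expr0n.
have I3 := intgZ 4 (intg_mart_noise n 3).
have I2 := intgZ (8 * L ^+ 2) (intg_mart n 2).
have I4 := intg_cst P (3 * L ^+ 4).
have I43 := intgD (intg_mart n 4) I3.
have I24 := intgD I2 I4.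
apply: le_trans (_ : Ex P (fun w =>
  (mart n w ^+ 4 + 4 * (mart n w ^+ 3 * noise n.+1 w)) +
  (8 * L ^+ 2 * mart n w ^+ 2 + 3 * L ^+ 4)) <= _).
  apply: le_Ex; [exact: intg_mart|exact: intgD|move=> w].
  by rewrite martS; exact/pow4_add_le/noise_le.
rewrite (ExD I43 I24) (ExD (intg_mart n 4) I3) (ExD I2 I4) (ExZ _ (intg_mart_noise n 3)).
rewrite (ExZ _ (intg_mart n 2)) Ex_cst mart_orthogonal mulr0 addr0.
rewrite -[n.+1%:R]natr1; apply: pow4_rec_le => //; exact: mart_sqr_le.
Qed.

Hypothesis psi_e_gt0 : 0 < psi e m.

Lemma mart_sqr_ge : exists N, forall n, (N <= n)%N ->
  psi e m / 4 * n%:R <= Ex P (fun w => mart n w ^+ 2).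
Proof.
have s0 := psi_e_gt0; pose K := 6 * C * `|e| ^+ 2; set s := psi e m in s0 *.
have K0 : 0 <= K by rewrite !mulr_ge0 ?sqr_ge0// ltW.
(* Chosen so that E r_n below this value costs at most half of the limiting variance s. *)
have sK : 0 < s / (2 * (K + 1)) by rewrite divr_gt0// mulr_gt0//; lra.
have [N1 h1] := Z_rate1 ltr01; have [N2 h2] := gamma_fast sK.
pose N := maxn 1 (maxn N1 N2).
have step n : (N <= n)%N -> s / 2 <= Ex P (fun w => noise n w ^+ 2).
  rewrite !geq_max => /and3P[n1 /h1 hr /h2 hg].
  apply: le_trans (noise_variance n1); rewrite -/s -/K.
  have : K * Ex P (r n) <= K * (s / (2 * (K + 1))).
    by rewrite ler_wpM2l// (le_trans hr)// mul1r.
  have : K * (s / (2 * (K + 1))) <= s / 2.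
    rewrite mulrA ler_pdivrMr; last by rewrite mulr_gt0//; lra.
    nra.
  lra.
have low n : (N <= n)%N -> s / 2 * (n - N)%:R <= Ex P (fun w => mart n w ^+ 2).
  move=> /subnK {2}<-; elim: (n - N)%N => [|k IH].
    by rewrite mulr0 Ex_ge0// => w; exact: sqr_ge0.
  rewrite addSn mart_sqrS -[k.+1%:R]natr1 mulrDr mulr1 lerD// step//.
  by rewrite -addSn leq_addl.
(* Beyond 2 N at least half of the increments contribute s/2 each, hence s/4. *)
exists (2 * N)%N => n Nn; have Nn' : (N <= n)%N.
  by rewrite (leq_trans _ Nn)// mul2n -addnn leq_addr.
apply: le_trans (low n Nn'); rewrite natrB//.
have : 2 * N%:R <= n%:R :> R by rewrite -natrM ler_nat.
by move=> h; have := ler_wpM2l (ltW s0) h; lra.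
Qed.

Lemma mart_norm_ge : exists2 k : R, 0 < k & exists N, forall n, (N <= n)%N ->
  k * Num.sqrt n%:R <= Ex P (fun w => `|mart n w|).
Proof.
have s0 := psi_e_gt0; have [N hN] := mart_sqr_ge; set s := psi e m in s0 hN *.
(* Interpolation at level K sqrt n: the fourth-moment term is at most 8 L^4 n / K^2, and 64 L^4 <= s
   K^2 makes it half of the lower bound s n / 4. The summand 1 ensures K^2 >= K. *)
pose K := 1 + 64 * L ^+ 4 / s.
have L4 : 0 <= 64 * L ^+ 4 by rewrite mulr_ge0// exprn_even_ge0.
have K1 : 1 <= K by rewrite /K lerDl divr_ge0// ltW.
have KL : 64 * L ^+ 4 <= s * K ^+ 2.
  apply: le_trans (_ : s * K <= _); last first.
    by rewrite ler_pM2l// expr2 ler_peMr//; lra.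
  by rewrite /K mulrDr mulr1 [s * (_ / _)]mulrC divfK ?gt_eqF// lerDr ltW.
have K0 : 0 < K by lra.
exists (s / (8 * K)); first by rewrite divr_gt0// mulr_gt0.
exists (maxn 1 N) => n; rewrite geq_max => /andP[n1 /hN S].
have q0 : 0 < Num.sqrt (n%:R : R) by rewrite sqrtr_gt0 ltr0n.
have qE : Num.sqrt (n%:R : R) ^+ 2 = n%:R by rewrite sqr_sqrtr.
have Kq : 0 < K * Num.sqrt n%:R by rewrite mulr_gt0.
have I1 : intg P (fun w => `|mart n w|).
  by have := intg_abs (intg_mart n 1).
have I4 := intgZ ((K * Num.sqrt n%:R) ^- 2) (intg_mart n 4).
have I1' := intgZ (K * Num.sqrt n%:R) I1.
have : Ex P (fun w => mart n w ^+ 2) <= K * Num.sqrt n%:R * Ex P (fun w => `|mart n w|) +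
    (K * Num.sqrt n%:R) ^- 2 * Ex P (fun w => mart n w ^+ 4).
  rewrite -ExZ// -ExZ; last exact: intg_mart.
  rewrite -ExD//; apply: le_Ex; [exact: intg_mart|exact: intgD|move=> w].
  by rewrite [X in _ + X]mulrC; exact: sqr_le_interpolation.
have := mart_pow4_le n.
move: S; set S := Ex P _; set F := Ex P _; set A := Ex P _.
move=> Sn Fn SAF.
have FK : (K * Num.sqrt n%:R) ^- 2 * F <= s / 8 * n%:R.
  rewrite mulrC ler_pdivrMr ?exprn_gt0// exprMn qE (le_trans Fn)//.
  have := ler_wpM2r (sqr_ge0 (n%:R : R)) KL; lra.
rewrite -(ler_pM2l Kq); apply: le_trans (_ : s / 8 * n%:R <= _); last lra.
rewrite -[X in s / 8 * X]qE le_eqVlt; apply/orP; left; apply/eqP; field.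
by rewrite gt_eqF.
Qed.

(** * Abel remainder and linearization error *)

Definition drive n w : R :=
  \sum_(1 <= k < n.+1) ip (dir ((Xs k.+1 w : H) - Z k w)) e.
Definition coord n w : R := ip (Z n w - m) e.

Lemma coord_le n w : `|coord n w| <= `|e| * r n w.
Proof. by rewrite mulrC; exact: (cauchy_schwarz ipP). Qed.

Lemma intg_coord n : (1 <= n)%N -> intg P (coord n).
Proof.
move=> n1; apply: le_intg (intgZ `|e| (intg_r n1)) (coord_le n).
apply: (borel_ip ipP sepH); last exact: borel_cst.
by apply: (borelB sepH); [exact: Z_measurable|exact: borel_cst].
Qed.

Lemma intg_drive n : intg P (drive n).
Proof.
apply: intg_sum => k /andP[k1 _].
apply: (@bounded_intg _ _ _ _ _ `|e|) => [|w]; last exact: (ip_dir_le ipP).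
apply: (borel_ip ipP sepH); last exact: borel_cst.
apply: (borel_dir ipP sepH); apply: (borelB sepH); first exact: measurable_funPT.
exact: Z_measurable.
Qed.

(* Abel summation of [(coord k.+1 - coord k) / gamma k]. *)
Let resid n w : R := drive n w - (gamma n)^-1 * coord n.+1 w.

Let intg_resid n : intg P (resid n).
Proof. by apply: intgB; [exact: intg_drive|exact/intgZ/intg_coord]. Qed.

(** The increment of [resid] is (1/gamma n - 1/gamma n.+1) times [coord n.+1], and [gamma_decr]
    bounds the coefficient by 1/(n gamma n.+1). *)
Let residS n w : (1 <= n)%N ->
  `|resid n.+1 w| <= `|resid n w| + `|e| / (n%:R * gamma n.+1) * r n.+1 w.
Proof.
move=> n1; have g0 := gamma_gt0 n1; have g1 := gamma_gt0 (leqW n1).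
have -> : resid n.+1 w =
    resid n w + ((gamma n)^-1 - (gamma n.+1)^-1) * coord n.+1 w.
  have cS : coord n.+2 w =
      coord n.+1 w + gamma n.+1 * ip (dir ((Xs n.+2 w : H) - Z n.+1 w)) e.
    by rewrite /coord (Z_stepE _ (ltn0Sn n)) [_ + _ - m]addrAC (ipDl ipP) (ipZl ipP).
  rewrite /resid cS /drive big_nat_recr//=.
  by field; rewrite !gt_eqF.
rewrite (le_trans (ler_normD _ _))// lerD2l normrM.
apply: le_trans (_ : (n%:R * gamma n.+1)^-1 * (`|e| * r n.+1 w) <= _); last first.
  by rewrite mulrA [_^-1 * _]mulrC.
apply: ler_pM => //; last exact: coord_le.
have nR : 0 < n%:R :> R by rewrite ltr0n.
have /andP[d0 d1] := gamma_decr n1.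
have -> : (gamma n)^-1 - (gamma n.+1)^-1 =
    - ((gamma n - gamma n.+1) / (gamma n * gamma n.+1)).
  by field; rewrite !gt_eqF.
rewrite normrN ger0_norm; last by rewrite divr_ge0 ?mulr_ge0 ?(ltW g0) ?(ltW g1).
rewrite ler_pdivrMr ?mulr_gt0// (le_trans d1)//.
rewrite le_eqVlt; apply/orP; left; apply/eqP; field.
by rewrite !gt_eqF.
Qed.

Lemma drive_small : small_sqrt (fun n => Ex P (fun w => `|drive n w|)).
Proof.
have e1 : 0 < 2 * `|e| + 1 by rewrite ltr_wpDl// mulr_ge0.
(* The rate at n.+1 expressed with sqrt n, at the price of the factor 2 in [sqrt_natS_le]; the 1 in
   2 |e| + 1 allows e = 0. *)
have rate eps : 0 < eps -> exists N, forall n, (N <= n)%N ->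
    [/\ (1 <= n)%N & `|e| * Ex P (r n.+1) <= eps * (Num.sqrt n%:R * gamma n.+1)].
  move=> eps0; have [N hN] := Z_rate1 (divr_gt0 eps0 e1).
  exists (maxn 1 N) => n; rewrite geq_max => /andP[n1 Nn]; split=> //.
  have g1 := gamma_gt0 (leqW n1).
  have h1 := hN _ (leqW Nn).
  apply: le_trans (ler_wpM2l (normr_ge0 e) h1) _.
  have h2 := ler_wpM2r (ltW g1) (sqrt_natS_le R n1).
  apply: le_trans (ler_wpM2l (normr_ge0 e) (ler_wpM2l (ltW (divr_gt0 eps0 e1)) h2)) _.
  rewrite [leLHS](_ : _ = eps * (Num.sqrt n%:R * gamma n.+1) *
      (2 * `|e| / (2 * `|e| + 1))); last first.
    by field; rewrite gt_eqF.
  apply: ler_piMr; first by rewrite !mulr_ge0 ?sqrtr_ge0 ?ltW.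
  by rewrite ler_pdivrMr// mul1r lerDl.
have sres : small_sqrt (fun n => Ex P (fun w => `|resid n w|)).
  apply: (@small_sqrt_sum _ _ (fun n => `|e| / (n%:R * gamma n.+1) * Ex P (r n.+1))).
    move=> n n1; have Ir := intg_r (leqW n1).
    rewrite -ExZ// -ExD; [|exact/intg_abs/intg_resid|exact: intgZ].
    apply: le_Ex; [exact/intg_abs/intg_resid| |by move=> w; exact: residS].
    by apply: intgD; [exact/intg_abs/intg_resid|exact: intgZ].
  move=> eps eps0; have [N hN] := rate _ eps0; exists N => n /hN[n1 h].
  have g1 := gamma_gt0 (leqW n1); have nR : 0 < n%:R :> R by rewrite ltr0n.
  rewrite [leLHS](_ : _ = Num.sqrt n%:R / (n%:R * gamma n.+1) *
      (`|e| * Ex P (r n.+1))); last first.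
    by field; rewrite !gt_eqF.
  apply: le_trans (ler_wpM2l _ h) _.
    by rewrite divr_ge0 ?sqrtr_ge0// mulr_ge0 ?ltW.
  have qE : Num.sqrt (n%:R : R) ^+ 2 = n%:R by rewrite sqr_sqrtr.
  rewrite le_eqVlt; apply/orP; left; apply/eqP; rewrite -[in X in _ / X]qE; field.
  by rewrite !gt_eqF// sqrtr_gt0.
have scoord : small_sqrt (fun n => (gamma n)^-1 * Ex P (fun w => `|coord n.+1 w|)).
  move=> eps eps0; have [N hN] := rate _ eps0; exists N => n /hN[n1 h].
  have g0 := gamma_gt0 n1; have g1 := gamma_gt0 (leqW n1).
  rewrite mulrC ler_pdivrMr//; apply: le_trans (le_trans _ h) _.
    rewrite -ExZ; last exact: intg_r.
    apply: le_Ex => [||w]; [exact/intg_abs/intg_coord|exact/intgZ/intg_r|].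
    exact: coord_le.
  rewrite mulrA; apply: ler_wpM2l; first by rewrite mulr_ge0 ?sqrtr_ge0 ?(ltW eps0).
  by have /andP[] := gamma_decr n1; rewrite subr_ge0.
move=> eps eps0; have [N hN] := small_sqrtD sres scoord eps0.
exists (maxn 1 N) => n; rewrite geq_max => /andP[n1 /hN]; apply: le_trans.
have g0 := gamma_gt0 n1; have Ic := intg_abs (intg_coord (leqW n1)).
rewrite -ExZ// -ExD; [|exact/intg_abs/intg_resid|exact: intgZ].
apply: le_Ex; first exact/intg_abs/intg_drive.
  by apply: intgD; [exact/intg_abs/intg_resid|exact: intgZ].
move=> w; rewrite -[drive n w](subrK ((gamma n)^-1 * coord n.+1 w)).
rewrite (le_trans (ler_normD _ _))// lerD2l normrM ger0_norm// invr_ge0 ltW//.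
Qed.

(** The summands are O(gamma n), and [gamma_fast] makes them o(1/sqrt n). *)
Lemma sum_sqr_small :
  small_sqrt (fun n => \sum_(1 <= k < n.+1) Ex P (fun w => r k w ^+ 2)).
Proof.
apply: (@small_sqrt_sum _ _ (fun n => Ex P (fun w => r n.+1 w ^+ 2))).
  by move=> n n1; rewrite [leLHS]big_nat_recr.
move=> eps eps0; have [B B0 [N1 h1]] := Z_rate.
have [N2 h2] := gamma_fast (divr_gt0 eps0 B0).
exists (maxn N1 N2) => n; rewrite geq_max => /andP[Nn1 Nn2].
have hr := h1 _ (leqW Nn1); have hg := h2 _ (leqW Nn2).
apply: le_trans (_ : Num.sqrt n.+1%:R * (B * gamma n.+1) <= _).
  rewrite ler_pM ?sqrtr_ge0//; first by apply: Ex_ge0 => w; exact: sqr_ge0.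
  by rewrite ler_wsqrtr// ler_nat.
by move: hg; rewrite ler_pdivlMr// mulrA mulrC mulrA mulrC; lra.
Qed.

Lemma mart_decomposition n w :
  `|mart n w| <= `|drive n w| + 4 * C * `|e| * \sum_(1 <= k < n.+1) r k w ^+ 2
    + 2 * C * `|e| * `|\sum_(1 <= k < n.+1) (Z k w - m)|.
Proof.
(* The linearization error. The part - hess (Z_k - m) e of the mean step is linear, so its sum
   involves only the sum of the deviations, that is n times the deviation of the average. *)
pose dl k := phi e (Z k w) + hess (Z k w - m) e.
have -> : mart n w = drive n w - \sum_(1 <= k < n.+1) dl k +
    hess (\sum_(1 <= k < n.+1) (Z k w - m)) e.
  rewrite /mart /drive (hess_sum ipP sepH m invX) -sumrB -big_split/=.
  by apply: eq_bigr => k _; rewrite /noise /dl opprD addrA subrK.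
rewrite (le_trans (ler_normD _ _))// lerD//; last first.
  rewrite (le_trans (hess_bound ipP sepH m invX _ _))//.
  by rewrite le_eqVlt; apply/orP; left; apply/eqP; ring.
rewrite (le_trans (ler_normB _ _))// lerD2l (le_trans (ler_norm_sum _ _ _))//.
rewrite mulr_sumr ler_sum// => k _.
have zE : m + (Z k w - m) = Z k w by rewrite addrC subrK.
have := phi_expansion ipP sepH C_gt0 invX medX (Z k w - m) e.
rewrite zE => /le_trans; apply.
by rewrite le_eqVlt; apply/orP; left; apply/eqP; rewrite /r; ring.
Qed.

Lemma intg_norm_sum n : intg P (fun w => `|\sum_(1 <= k < n.+1) (Z k w - m)|).
Proof.
have Is : intg P (fun w => \sum_(1 <= k < n.+1) r k w).
  by apply: intg_sum => k /andP[k1 _]; exact: intg_r.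
apply: le_intg Is _ => [|w]; last first.
  by rewrite normr_id; exact: ler_norm_sum.
apply: borel_norm; apply: (borel_sum sepH) => k /andP[k1 _].
by apply: (borelB sepH); [exact: Z_measurable|exact: borel_cst].
Qed.

Lemma sum_norm_ge : exists2 k : R, 0 < k & exists N, forall n, (N <= n)%N ->
  k * Num.sqrt n%:R <= Ex P (fun w => `|\sum_(1 <= k < n.+1) (Z k w - m)|).
Proof.
have [k k0 [N1 h1]] := mart_norm_ge.
have Ce : 0 <= 4 * C * `|e| by rewrite !mulr_ge0// ltW.
have k20 : 0 < k / 2 by rewrite divr_gt0.
have [N2 h2] := small_sqrtD drive_small (small_sqrtZ Ce sum_sqr_small) k20.
pose K := 2 * C * `|e| + 1.
have K0 : 0 < K by rewrite ltr_wpDl// !mulr_ge0// ltW.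
(* Half of the martingale bound is spent on the two small terms, and K dominates the norm of v ->
   hess v e. *)
exists (k / 2 / K); first by rewrite divr_gt0.
exists (maxn N1 N2) => n; rewrite geq_max => /andP[/h1 hm /h2 hs].
rewrite [leLHS]mulrAC ler_pdivrMr//.
have I1 := intg_abs (intg_drive n).
have I2' : intg P (fun w => \sum_(1 <= k < n.+1) r k w ^+ 2).
  by apply: intg_sum => j /andP[j1 _]; exact: intg_r2.
have I2 := intgZ (4 * C * `|e|) I2'.
have I3 := intgZ (2 * C * `|e|) (intg_norm_sum n).
have : Ex P (fun w => `|mart n w|) <= Ex P (fun w =>
    `|drive n w| + 4 * C * `|e| * (\sum_(1 <= k < n.+1) r k w ^+ 2)
    + 2 * C * `|e| * `|\sum_(1 <= k < n.+1) (Z k w - m)|).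
  apply: le_Ex; [by have := intg_abs (intg_mart n 1)| |exact: mart_decomposition].
  by apply: intgD => //; exact: intgD.
rewrite (ExD (intgD I1 I2) I3) (ExD I1 I2) (ExZ _ I2') (ExZ _ (intg_norm_sum n)).
rewrite Ex_sum; last by move=> j /andP[j1 _]; exact: intg_r2.
have : 0 <= Ex P (fun w => `|\sum_(1 <= k < n.+1) (Z k w - m)|).
  by apply: Ex_ge0 => w.
rewrite /K; move: hm hs.
set a := Ex P _; set b := Ex P _; set c := Ex P (fun w => `|\sum_(1 <= k < n.+1) _|).
set q := Num.sqrt _; set z := \sum_(_ <= _ < _) _; clearbody a b c q z; lra.
Qed.

End martingale.

(** * Lower bounds for the averaged sequence *)

Lemma averagedBE n w : (1 <= n)%N ->
  averaged Z n w - m = n%:R^-1 *: \sum_(1 <= k < n.+1) (Z k w - m).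
Proof.
move=> n1; rewrite sumrB scalerBr sumr_const_nat subSS subn0 -[m *+ n]scaler_nat scalerA.
by rewrite mulVf ?scale1r// pnatr_eq0 -lt0n.
Qed.

Lemma intg_averaged_sqr n : (1 <= n)%N ->
  intg P (fun w => `|averaged Z n w - m| ^+ 2).
Proof.
move=> n1.
have Zb k : exists K, (1 <= k)%N -> forall w, `|Z k w - m| <= K.
  by have [/Zm_bounded[K ZK]|] := leqP 1 k; [exists K|exists 0].
pose K k := projT1 (cid (Zb k)).
have KP k : (1 <= k)%N -> forall w, `|Z k w - m| <= K k := projT2 (cid (Zb k)).
apply: (@bounded_intg _ _ _ _ _ ((n%:R^-1 * \sum_(1 <= k < n.+1) K k) ^+ 2)).
  apply: measurable_funX; apply: borel_norm.
  under eq_fun do rewrite averagedBE//.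
  apply: (borelZ ipP sepH) => //; apply: (borel_sum sepH) => k /andP[k1 _].
  by apply: (borelB sepH); [exact: Z_measurable|exact: borel_cst].
move=> w; rewrite normrX normr_id averagedBE// normrZ ger0_norm ?invr_ge0//.
have S : `|\sum_(1 <= k < n.+1) (Z k w - m)| <= \sum_(1 <= k < n.+1) K k.
  rewrite (le_trans (ler_norm_sum _ _ _))// big_nat [leRHS]big_nat ler_sum//.
  by move=> k /andP[k1 _]; exact: KP.
have S0 : 0 <= \sum_(1 <= k < n.+1) K k by exact: le_trans S.
by rewrite lerXn2r ?nnegrE ?mulr_ge0 ?invr_ge0// ler_wpM2l ?invr_ge0.
Qed.

Lemma averaged_asymptotic : exists2 c : R, 0 < c & exists N, forall n, (N <= n)%N ->
  c / n%:R <= Ex P (fun w => `|averaged Z n w - m| ^+ 2).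
Proof.
have [e psi0] := psi_gt0 ipP sepH m nondegX.
have [k k0 [N hN]] := sum_norm_ge psi0.
exists (k ^+ 2); first by rewrite exprn_gt0.
exists (maxn 1 N) => n; rewrite geq_max => /andP[n1 /hN h].
have nR : 0 < n%:R :> R by rewrite ltr0n.
have I2 := intg_averaged_sqr n1; have I1 := intg_norm_sum n.
have E w : `|averaged Z n w - m| = n%:R^-1 * `|\sum_(1 <= k < n.+1) (Z k w - m)|.
  by rewrite averagedBE// normrZ ger0_norm// invr_ge0.
have I1' : intg P (fun w => `|averaged Z n w - m|).
  rewrite (_ : (fun _ => _) = fun w => n%:R^-1 *
    `|\sum_(1 <= k < n.+1) (Z k w - m)|); [exact: intgZ|exact/funext].
apply: le_trans (sqr_Ex_le I1' I2).
rewrite (@eq_Ex _ _ _ P _ _ E) ExZ// exprMn.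
apply: le_trans (_ : n%:R^-1 ^+ 2 * (k * Num.sqrt n%:R) ^+ 2 <= _).
  rewrite exprMn sqr_sqrtr// le_eqVlt; apply/orP; left; apply/eqP; field.
  by rewrite gt_eqF.
rewrite ler_wpM2l ?sqr_ge0// lerXn2r ?nnegrE ?mulr_ge0 ?sqrtr_ge0 ?(ltW k0)//.
by apply: Ex_ge0.
Qed.

Lemma averaged_nondegenerate n : (1 <= n)%N ->
  (n = 1%N -> ~ (\forall w \ae P, Z 1%N w = m)) ->
  0 < Ex P (fun w => `|averaged Z n w - m| ^+ 2).
Proof.
move=> n1 nd; rewrite lt0r Ex_ge0 ?andbT => [|w]; last exact: sqr_ge0.
apply/eqP => E0.
have {E0} avm : \forall w \ae P, averaged Z n w = m.
  apply: filterS (Ex_eq0 (intg_averaged_sqr n1) (fun w => sqr_ge0 _) E0) => w.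
  by move=> /eqP; rewrite sqrf_eq0 normr_eq0 subr_eq0 => /eqP.
case: n n1 nd avm => // -[_ nd|n _ _ avm].
  move=> av1; apply: (nd erefl); apply: filterS av1 => w.
  by rewrite /averaged big_nat1 invr1 scale1r.
have g1 := gamma_gt0 (ltn0Sn n).
(* The value that the last direction must take for the average of n.+2 iterates to equal m; it is a
   function of X_1, ..., X_(n+1). *)
pose V w : H := (gamma n.+1)^-1 *:
  (n.+2%:R *: m - \sum_(1 <= k < n.+2) Z k w - Z n.+1 w).
have dV : \forall w \ae P, dir ((Xs n.+2 w : H) - Z n.+1 w) = V w.
  apply: filterS avm => w; rewrite /averaged => avw.
  have : \sum_(1 <= k < n.+3) Z k w = n.+2%:R *: m.
    by rewrite -avw scalerA mulfV ?pnatr_eq0// scale1r.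
  rewrite big_nat_recr//= (Z_stepE _ (ltn0Sn n)) => S.
  rewrite /V -S [in RHS](addrC (\sum_(_ <= _ < _) _)) addrK [in RHS]addrC addKr.
  by rewrite scalerA mulVf ?gt_eqF// scale1r.
have mV : past_borel n.+1 V.
  have mZ k : (1 <= k < n.+2)%N -> past_borel n.+1 (Z k).
    move=> /andP[k1]; rewrite ltnS => /subnKC <-.
    elim: (n.+1 - k)%N => [|j IH]; first by rewrite addn0; exact: Z_past.
    by rewrite addnS; exact: past_measurable_funS.
  apply: (borelZ ipP sepH) => //; apply: (borelB sepH); last exact: Z_past.
  by apply: (borelB sepH); [exact: borel_cst|exact: (borel_sum sepH)].
(* Indicator that the direction differs from V. Freezing the past yields one outcome w for which the
   direction of a fresh X from Z_(n+1) w is almost surely V w, which [not_on_ray] forbids. *)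
pose f (y : past Xs n.+1 * borelType H) : R :=
  if `|dir ((y.2 : H) - Z n.+1 y.1) - V y.1| == 0 then 0 else 1.
have mf : measurable_fun setT f.
  apply: measurable_fun_ifT => //; apply: measurable_fun_eqr => //.
  apply: (borel_dist2 sepH (past_dir (ltn0Sn n))).
  exact: (measurableT_comp mV measurable_fst).
have f01 y : 0 <= f y <= 1 by rewrite /f; case: ifP => _; rewrite ?lexx ler01.
have f0 y : 0 <= f y by have /andP[] := f01 y.
have fK y : `|f y| <= 1 by rewrite ger0_norm//; have /andP[] := f01 y.
have fE y : f y = 0 -> dir ((y.2 : H) - Z n.+1 y.1) = V y.1.
  rewrite /f; case: ifP => [+ _|_ /eqP]; last by rewrite oner_eq0.
  by rewrite normr_eq0 subr_eq0 => /eqP.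
have mfX : measurable_fun setT (fun w => f (w, Xs n.+2 w)).
  apply: measurable_fun_ifT => //; apply: measurable_fun_eqr => //.
  apply: (borel_dist2 sepH); last exact: past_measurable_fun mV.
  apply: (borel_dir ipP sepH); apply: (borelB sepH); first exact: measurable_funPT.
  exact: Z_measurable.
have mfw w : measurable_fun setT (fun w' => f (w, X w')).
  exact: (measurableT_comp (measurable_fun_pair2 (w : past Xs n.+1) mf) mX).
have Ef : Ex P (fun w => f (w, Xs n.+2 w)) = 0.
  rewrite (@ae_eq_Ex _ _ _ P _ (fun=> 0)) ?Ex_cst//.
  by apply: filterS dV => w dVw; rewrite /f /= dVw subrr normr0 eqxx.
rewrite (past_freezing indX lawX mf fK) in Ef.
have If : intg P (fun w => Ex P (fun w' => f (w, X w'))).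
  apply: (@bounded_intg _ _ _ _ _ 1).
    exact: past_measurable_fun (past_freezing_measurable X mf fK).
  by move=> w; apply: Ex_bounded => //; exact: mfw.
have [w Ew] := ae_ex (Ex_eq0 If (fun w => Ex_ge0 P (fun w' => f0 (w, X w'))) Ef).
have Ifw : intg P (fun w' => f (w, X w')).
  by apply: (@bounded_intg _ _ _ _ _ 1) => //; exact: mfw.
apply: (not_on_ray ipP sepH nondegX (z := Z n.+1 w) (b := V w)).
by apply: filterS (Ex_eq0 Ifw (fun w' => f0 _) Ew) => w' /fE.
Qed.

Lemma bounded_lower_bound : exists2 c : R, 0 < c &
  forall n, (1 <= n)%N -> (n = 1%N -> ~ (\forall w \ae P, Z 1%N w = m)) ->
    c / n%:R <= Ex P (fun w => `|averaged Z n w - m| ^+ 2).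
Proof.
have [c c0 [N hN]] := averaged_asymptotic.
pose V n := Ex P (fun w => `|averaged Z n w - m| ^+ 2).
(* Only finitely many n remain, each with a positive second moment; the minimum is built by
   induction on N, skipping 0 and a degenerate n = 1. *)
suff [b b0 hb] : exists2 b : R, 0 < b & forall n, (n < N)%N -> (1 <= n)%N ->
    (n = 1%N -> ~ (\forall w \ae P, Z 1%N w = m)) -> b / n%:R <= V n.
  exists (Num.min b c); first by rewrite lt_min b0.
  move=> n n1 nd; have n0 : 0 <= (n%:R : R)^-1 by rewrite invr_ge0.
  have [nN|Nn] := ltnP n N.
    by rewrite (le_trans _ (hb n nN n1 nd))// ler_wpM2r// ge_min lexx.
  by rewrite (le_trans _ (hN n Nn))// ler_wpM2r// ge_min lexx orbT.
elim: N {hN} => [|N [b b0 hb]]; first by exists 1.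
have [[N1 nd]|deg] := pselect ((1 <= N)%N /\
    (N = 1%N -> ~ (\forall w \ae P, Z 1%N w = m))); last first.
  exists b => // n; rewrite ltnS leq_eqVlt => /predU1P[->|] n1; last exact: hb.
  by move=> nd; exfalso; apply: deg.
have V0 := averaged_nondegenerate N1 nd.
exists (Num.min b (V N)); first by rewrite lt_min b0.
move=> n; rewrite ltnS leq_eqVlt => /predU1P[-> _ _|n1 n1' nd'].
  apply: le_trans (_ : V N / N%:R <= _).
    by rewrite ler_wpM2r ?invr_ge0// ge_min lexx orbT.
  by rewrite ler_pdivrMr ?ltr0n// ler_peMr ?(ltW V0)// ler1n.
rewrite (le_trans _ (hb n n1 n1' nd'))// ler_wpM2r ?invr_ge0//.
by rewrite ge_min lexx.
Qed.

End process.

(** * Power step sizes and conclusion *)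

Section power_steps.
Context (R : realType).
Variables (a c : R).
Hypotheses (a_gt : 2^-1 < a) (a_lt : a < 1) (c_gt0 : 0 < c).

Let gamma (n : nat) : R := c * n%:R `^ (- a).

Lemma powR_nat_unbounded (s k : R) : 0 < s ->
  exists N, forall n, (N <= n)%N -> k <= n%:R `^ s.
Proof.
move=> s0; have [N hN] := nat_above (`|k| `^ s^-1).
exists N => n Nn; rewrite (le_trans (ler_norm k))//.
have -> : `|k| = (`|k| `^ s^-1) `^ s by rewrite -powRrM mulVf ?gt_eqF// powRr1.
apply: ge0_ler_powR; rewrite ?nnegrE ?powR_ge0//; first exact: ltW.
by rewrite (le_trans hN)// ler_nat.
Qed.

Lemma power_step_gt0 n : (1 <= n)%N -> 0 < gamma n.
Proof. by move=> n1; rewrite mulr_gt0// powR_gt0// ltr0n. Qed.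

Lemma power_step_decr n : (1 <= n)%N ->
  0 <= gamma n - gamma n.+1 <= gamma n / n%:R.
Proof.
move=> n1; have nR : 0 < n%:R :> R by rewrite ltr0n.
have n1R : 0 < n.+1%:R :> R by rewrite ltr0n.
have p0 : 0 < (n%:R : R) `^ a by rewrite powR_gt0.
have p1 : 0 < (n.+1%:R : R) `^ a by rewrite powR_gt0.
have pp : (n%:R : R) `^ a <= n.+1%:R `^ a.
  apply: ge0_ler_powR; rewrite ?nnegrE// ?ler_nat//.
  by rewrite (le_trans _ (ltW a_gt)).
(* The ratio (n+1)/n is at least 1, so its power a <= 1 does not exceed it. *)
have ppn : n.+1%:R `^ a * n%:R <= (n%:R : R) `^ a * n.+1%:R.
  have -> : n.+1%:R = n%:R * (n.+1%:R / n%:R) :> R by field; rewrite gt_eqF.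
  rewrite powRM ?divr_ge0//.
  rewrite -mulrA ler_pM2l// -[leRHS]mulrC ler_pM2r//.
  apply: ler1_powR; last exact: ltW.
  by rewrite ler_pdivlMr// mul1r ler_nat.
rewrite /gamma !powRN -mulrBr -mulrA; apply/andP; split.
  by rewrite mulr_ge0 ?(ltW c_gt0)// subr_ge0 lef_pV2.
rewrite ler_pM2l//; rewrite -[in X in _ <= X]natr1 in ppn.
set p := n%:R `^ a in p0 pp ppn *; set q := n.+1%:R `^ a in p1 pp ppn *.
have -> : p^-1 - q^-1 = (q - p) / (p * q) by field; rewrite !gt_eqF.
rewrite -invfM ler_pdivrMr ?mulr_gt0//.
have -> : (p * n%:R)^-1 * (p * q) = q / n%:R by field; rewrite !gt_eqF.
rewrite ler_pdivlMr//; lra.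
Qed.

Lemma power_step_fast (e : R) : 0 < e ->
  exists N, forall n, (N <= n)%N -> Num.sqrt n%:R * gamma n <= e.
Proof.
move=> e0; have s0 : 0 < a - 2^-1 by rewrite subr_gt0.
have [N hN] := powR_nat_unbounded (c / e) s0.
exists (maxn 1 N) => n; rewrite geq_max => /andP[n1 /hN].
have nR : 0 < n%:R :> R by rewrite ltr0n.
rewrite -powR12_sqrt// /gamma powRN powRB ?(gt_eqF nR) ?implybT//.
have p0 : 0 < (n%:R : R) `^ a by rewrite powR_gt0.
have q0 : 0 < (n%:R : R) `^ 2^-1 by rewrite powR_gt0.
rewrite ler_pdivrMr// mulrAC ler_pdivlMr// mulrA ler_pdivrMr//.
by rewrite [c * _]mulrC [e * _]mulrC.
Qed.

Lemma power_step_slow (k : R) :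
  exists N, forall n, (N <= n)%N -> k <= n%:R * gamma n.
Proof.
have s0 : 0 < 1 - a by rewrite subr_gt0.
have [N hN] := powR_nat_unbounded (k / c) s0.
exists (maxn 1 N) => n; rewrite geq_max => /andP[n1 /hN].
have nR : 0 < n%:R :> R by rewrite ltr0n.
rewrite powRB ?(gt_eqF nR) ?implybT// powRr1// ler_pdivrMr// /gamma powRN.
by move/le_trans; apply; rewrite le_eqVlt; apply/orP; left; apply/eqP; ring.
Qed.

End power_steps.

Lemma sigma_measurable_past d (T : measurableType d) (R : realType)
    (P : probability T R) (H : completeNormedModType R)
    (Xs : nat -> {RV P >-> borelType H}) (Y : T -> H) :
  sigma_measurable (Xs 1%N) (Y : T -> borelType H) ->
  measurable_fun setT (Y : past Xs 1 -> borelType H).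
Proof.
move=> mY _ B mB; have [D mD] := mY measurableT B mB.
by move=> <-; exact: past_measurable_last.
Qed.

(* Truncating [Z 1] makes every [Z n] bounded everywhere and not only almost
   surely. *)
Fixpoint truncated_sgd (R : realType) (H : normedModType R) (T : Type)
    (gamma : nat -> R) (M : R) (X Z : nat -> T -> H) (n : nat) (w : T) : H :=
  if n is k.+1 then
    if k is _.+1 then
      let z := truncated_sgd gamma M X Z k w in
      z + gamma k *: (`|X k.+1 w - z|^-1 *: (X k.+1 w - z))
    else (if `|Z 1%N w| <= M then 1 else 0) *: Z 1%N w
  else 0.

(* If [Z 1] is almost surely equal to [m], then the left-hand side vanishes for
   [n = 1]; this single degenerate case has to be excluded. *)
Theorem proposition4p1 (R : realType) (H : completeNormedModType R)
    (ip : {dot H for @idfun R}) (d : measure_display) (T : measurableType d)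
    (P : probability T R) (X : {RV P >-> borelType H}) (m : H)
    (Xs : nat -> {RV P >-> borelType H}) (Z : nat -> T -> H)
    (alpha c_gamma : R)
    (H_hilbert : norm_induced_by ip)
    (H_separable : separable_space H)
    (A1 : not_on_a_line ip X)
    (A2 : bounded_inverse_moments X)
    (m_median : geometric_median X m)
    (alpha_gt : 2^-1 < alpha) (alpha_lt : alpha < 1)
    (c_gamma_gt0 : 0 < c_gamma)
    (Xs_indep : mutually_independent [set n | (1 <= n)%N] Xs)
    (Xs_law : forall n, (1 <= n)%N -> same_law (Xs n) X)
    (Z1_measurable : sigma_measurable (Xs 1%N) (Z 1%N : T -> borelType H))
    (Z1_bounded : exists M : R, \forall w \ae P, `|Z 1%N w| <= M)
    (Z_step : stochastic_gradient
       (fun n => c_gamma * n%:R `^ (- alpha)) Xs Z) :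
  exists2 c : R, 0 < c &
    forall n : nat, (1 <= n)%N ->
      (n = 1%N -> ~ (\forall w \ae P, Z 1%N w = m)) ->
      ((c / n%:R)%R%:E <= 'E_P[(fun w => `|averaged Z n w - m| ^+ 2)%R])%E.
Proof.
have ipP := dot_inner_product H_hilbert.
have [C C0 invX] := A2; have [M Z1M] := Z1_bounded.
set gamma := (fun n => _) in Z_step.
pose Z' := truncated_sgd gamma M (fun n w => Xs n w : H) Z.
have Z1p := sigma_measurable_past Z1_measurable.
have Z'1p : measurable_fun setT (Z' 1%N : past Xs 1 -> borelType H).
  apply: (borelZ ipP H_separable) => //.
  apply: measurable_fun_ifT => //; apply: measurable_fun_ler => //.
  exact: borel_norm.
have Z'1b w : `|Z' 1%N w| <= `|M|.
  rewrite /Z'/=; case: ifPn => [Mw|_]; last by rewrite scale0r normr0.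
  by rewrite scale1r (le_trans Mw) ?ler_norm.
have Z'_step : stochastic_gradient gamma Xs Z' by case.
(* Wherever |Z_1| <= M the truncation is inactive and both sequences obey the same recursion, so one
   null set serves all n. *)
have ZZ' : \forall w \ae P, forall n, (1 <= n)%N -> Z' n w = Z n w.
  apply: filterS Z1M => w Mw; case=> // n _.
  elim: n => [|n IH]; first by rewrite /Z'/= Mw scale1r.
  by rewrite Z'_step// Z_step// IH.
have [c c0 low] := bounded_lower_bound ipP H_separable A1 C0 invX m_median
  Xs_indep Xs_law (power_step_gt0 alpha c_gamma_gt0)
  (power_step_decr alpha_gt alpha_lt c_gamma_gt0)
  (power_step_fast c_gamma alpha_gt)
  (power_step_slow alpha_lt c_gamma_gt0) Z'_step Z'1p Z'1b.
exists c => // n n1 nd.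
have mav (Y : nat -> T -> H) : (forall k, (1 <= k)%N ->
    measurable_fun setT (Y k : T -> borelType H)) ->
    measurable_fun setT (fun w => (`|averaged Y n w - m| ^+ 2)%:E).
  move=> mY; apply/measurable_EFinP/measurable_funX.
  apply: (borel_dist m (Y := averaged Y n)).
  apply: (borelZ ipP H_separable) => //.
  by apply: (borel_sum H_separable) => k /andP[k1 _]; exact: mY.
have mZ k : (1 <= k)%N -> measurable_fun setT (Z k : T -> borelType H).
  by move=> k1; exact: (Z_measurable ipP H_separable Z_step Z1p k1).
have mZ' k : (1 <= k)%N -> measurable_fun setT (Z' k : T -> borelType H).
  by move=> k1; exact: (Z_measurable ipP H_separable Z'_step Z'1p k1).
rewrite unlock (@ae_eq_integral _ _ _ P setT
  (fun w => (`|averaged Z' n w - m| ^+ 2)%:E)) //; try exact: mav.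
  rewrite -EFin_Ex ?lee_fin.
    apply: low => // n1' aem; apply: (nd n1').
    by apply: filterS2 ZZ' aem => w <-.
  exact: (intg_averaged_sqr ipP H_separable m
    (power_step_gt0 alpha c_gamma_gt0) Z'_step Z'1p Z'1b n1).
apply: filterS ZZ' => w ZZ'w _; congr ((`|_ - _| ^+ 2)%:E).
rewrite /averaged; congr (_ *: _); rewrite !big_nat; apply: eq_bigr => k /andP[k1 _].
by rewrite ZZ'w.
Qed.
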